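(* There exists a universal constant $C>0$ such that the following holds. Let $f=\frac1m\sum_{i=1}^m f_i$, let Assumptions (A1)–(A5) of the context hold, put $L_f=L_0+L_1\zeta$ and suppose $L_f>0$. Let $\epsilon>0$, $\bar{\mathbf x}^0\in\mathbb R^{1\times d}$ and $\hat K\in\mathbb N$. Run the algorithm DNSGD of the context with $$\eta=\min\Big\{\frac{\epsilon}{4L_f+1},\frac1{2L_1}\Big\},\qquad K=\Big\lceil \frac{C\log(\sqrt m(1+\eta))}{\sqrt\gamma}\Big\rceil,$$ and integers $b,T\ge 1$ satisfying $$b\ge\max\Big\{\frac{256(4L_f+1)^2\sigma^2}{mL_f^2\epsilon^2},\frac{1024L_1^2\sigma^2}{mL_f^2}\Big\},\qquad T\ge\max\Big\{\frac{8(4L_f+1)\Delta_\Phi}{\epsilon^2},\frac{16L_1\Delta_\Phi}{\epsilon}\Big\},$$ where $$\Delta_\Phi=f(\bar{\mathbf x}^0)-\inf_{\mathbf x\in\mathbb R^d}f(\mathbf x)+\frac{2\eta}{\sqrt m}\,\mathbb E\big[\|\mathbf V^0-\mathbf 1\bar{\mathbf v}^0\|\big].$$ Let $\hat{\mathbf x}$ be sampled uniformly (independently of everything else) from $\{\bar{\mathbf x}^0,\dots,\bar{\mathbf x}^{T-1}\}$. Then $\mathbb E[\|\nabla f(\hat{\mathbf x})\|]\le\epsilon/2$.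
   Context: Notation. $\|\cdot\|$ is the Euclidean norm of vectors and the Frobenius norm of matrices; $\mathbf 1=[1,\dots,1]^\top\in\mathbb R^m$. A matrix such as $\mathbf X\in\mathbb R^{m\times d}$ has rows $\mathbf x_1,\dots,\mathbf x_m$ (row $i$ is the local variable of agent $i$), and $\bar{\mathbf x}=\frac1m\mathbf 1^\top\mathbf X\in\mathbb R^{1\times d}$ is the mean of its rows (likewise $\bar{\mathbf v}$ for $\mathbf V$). Row and column vectors are identified as function inputs. $1/L_1:=+\infty$ if $L_1=0$. Assumptions. There are $m$ agents with differentiable functions $f_i:\mathbb R^d\to\mathbb R$, $f_i(\mathbf x)=\mathbb E[F_i(\mathbf x;\boldsymbol\xi_i)]$, $\boldsymbol\xi_i\sim\mathcal D_i$, and $f=\frac1m\sum_{i=1}^m f_i$. (A1) $\inf_{\mathbf x\in\mathbb R^d}f(\mathbf x)>-\infty$. (A2) Each $f_i$ is $(L_0,L_1)$-smooth with $L_0,L_1\ge0$: $\|\nabla f_i(\mathbf x)-\nabla f_i(\mathbf y)\|\le(L_0+L_1\|\nabla f_i(\mathbf x)\|)\|\mathbf x-\mathbf y\|$ for all $\mathbf x,\mathbf y\in\mathbb R^d$ with $\|\mathbf x-\mathbf y\|\le1/L_1$. (A3) There is $\zeta\ge0$ with $\|\nabla f_i(\mathbf x)-\nabla f(\mathbf x)\|\le\zeta$ for all $i$ and $\mathbf x\in\mathbb R^d$. (A4) There is $\sigma>0$ such that for all $i$ and $\mathbf x$: $\mathbb E[\nabla F_i(\mathbf x;\boldsymbol\xi_i)]=\nabla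 f_i(\mathbf x)$ and $\mathbb E[\|\nabla F_i(\mathbf x;\boldsymbol\xi_i)-\nabla f_i(\mathbf x)\|^2]\le\sigma^2$, where $\boldsymbol\xi_i\sim\mathcal D_i$. (A5) $\mathbf W\in\mathbb R^{m\times m}$ is the mixing matrix of a connected undirected network on the $m$ agents: $\mathbf W$ is symmetric with $w_{i,j}\ge0$, and $w_{i,j}\ne0$ iff agents $i,j$ are connected or $i=j$; $\mathbf 0\preceq\mathbf W\preceq\mathbf I$, $\mathbf W\mathbf 1=\mathbf W^\top\mathbf 1=\mathbf 1$, $\operatorname{null}(\mathbf I-\mathbf W)=\operatorname{span}(\mathbf 1)$. $\lambda_2(\mathbf W)\in[0,1)$ is the second largest eigenvalue of $\mathbf W$ (set to $0$ if $m=1$), and $\gamma=1-\lambda_2(\mathbf W)$. Subroutine AccGossip$(\mathbf Y^{(0)},\mathbf W,K)$: set $\mathbf Y^{(-1)}=\mathbf Y^{(0)}$, $\eta_y=\frac{1-\sqrt{1-\lambda_2(\mathbf W)^2}}{1+\sqrt{1-\lambda_2(\mathbf W)^2}}$, iterate $\mathbf Y^{(k+1)}=(1+\eta_y)\mathbf W\mathbf Y^{(k)}-\eta_y\mathbf Y^{(k-1)}$ for $k=0,1,\dots$, and output $\mathbf Y^{(K)}$. Algorithm DNSGD with inputs $\bar{\mathbf x}^0\in\mathbb R^{1\times d}$, $\mathbf W$, $\eta>0$, $\hat K,K,T,b\in\mathbb N$. Set $\mathbf X^0=\mathbf 1\bar{\mathbf x}^0$. For every $t\ge 0$, fresh samples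 $\boldsymbol\xi_{i,k}^t\sim\mathcal D_i$, $k=1,\dots,b$, are drawn by each agent $i$ (all samples mutually independent over $i,k,t$), and $\mathbf G^t$ is the matrix whose $i$th row is $\mathbf g_i^t=\frac1b\sum_{k=1}^b\nabla F_i(\mathbf x_i^t;\boldsymbol\xi_{i,k}^t)$. Set $\mathbf V^0=\mathrm{AccGossip}(\mathbf G^0,\mathbf W,\hat K)$. For $t=0,\dots,T-1$: let $\mathbf U^t$ be the matrix with $i$th row $\mathbf v_i^t/\|\mathbf v_i^t\|$ (taken to be $\mathbf 0$ if $\mathbf v_i^t=\mathbf 0$); $\mathbf X^{t+1}=\mathrm{AccGossip}(\mathbf X^t-\eta\mathbf U^t,\mathbf W,K)$; $\mathbf V^{t+1}=\mathrm{AccGossip}(\mathbf V^t+\mathbf G^{t+1}-\mathbf G^t,\mathbf W,K)$. *)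

(* Defs.v *)
(* MathComp / MathComp-Analysis *)
From HB Require Import structures.
From mathcomp Require Import all_boot all_order all_algebra.
From mathcomp Require Import all_classical all_reals all_analysis.

Set Implicit Arguments.
Unset Strict Implicit.
Unset Printing Implicit Defensive.

Import Order.TTheory GRing.Theory Num.Theory.
Import numFieldNormedType.Exports.

Local Open Scope classical_set_scope.
Local Open Scope ring_scope.

(** * Vectors and matrices *)

(* The library norm `|A| on matrices is the sup norm.  On 'rV[R]_d the Frobenius
   norm is the Euclidean norm. *)
Definition frob {R : realType} {p q : nat} (A : 'M[R]_(p, q)) : R :=
  Num.sqrt (\sum_i \sum_j A i j ^+ 2).

Definition grad {R : realType} {d : nat} (f : 'rV[R]_d -> R) (x : 'rV[R]_d)
    : 'rV[R]_d :=
  \row_j 'D_(delta_mx 0 j) f x.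

Definition mean_row {R : realType} {m d : nat} (X : 'M[R]_(m, d)) : 'rV[R]_d :=
  m%:R^-1 *: ((const_mx 1 : 'rV[R]_m) *m X).

(* The matrix 1 x, all of whose m rows are x. *)
Definition stack {R : realType} (m : nat) {d : nat} (x : 'rV[R]_d) : 'M[R]_(m, d) :=
  (const_mx 1 : 'cV[R]_m) *m x.

(* A zero row is sent to 0, since 0^-1 = 0. *)
Definition normalize_rows {R : realType} {m d : nat} (V : 'M[R]_(m, d))
    : 'M[R]_(m, d) :=
  \matrix_(i < m) ((frob (row i V))^-1 *: row i V).

Definition loewner_le {R : realType} {n : nat} (A B : 'M[R]_n) : Prop :=
  (B - A)^T = B - A /\ forall x : 'cV[R]_n, 0 <= (x^T *m (B - A) *m x) 0 0.

(* The eigenvalues of A with multiplicity, in nonincreasing order; [::] when the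
   characteristic polynomial does not split over R (it does for symmetric A). *)
Definition eigenvalues {R : realType} {n : nat} (A : 'M[R]_n) : seq R :=
  xget [::] [set s : seq R | sorted >=%R s /\
                             char_poly A = \prod_(l <- s) ('X - l%:P)].

(* Equal to 0 if n = 1, by the default value of the indexing notation. *)
Definition lambda2 {R : realType} {n : nat} (A : 'M[R]_n) : R := (eigenvalues A)`_1.

(** * Functions, networks, randomness *)

Definition average {R : realType} {m d : nat} (f : 'I_m -> 'rV[R]_d -> R)
    (x : 'rV[R]_d) : R :=
  m%:R^-1 * \sum_i f i x.

(* In \bar R, 0^-1 = +oo, so the radius 1 / L1 is infinite when L1 = 0. *)
Definition L0L1_smooth {R : realType} {d : nat} (L0 L1 : R) (f : 'rV[R]_d -> R)
    : Prop :=
  forall x y : 'rV[R]_d, ((frob (x - y))%:E <= (L1%:E)^-1)%E ->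
    frob (grad f x - grad f y) <= (L0 + L1 * frob (grad f x)) * frob (x - y).

(* [e] is the adjacency relation of the network. *)
Record mixing_matrix {R : realType} {m : nat} (e : rel 'I_m) (W : 'M[R]_m) : Prop := {
  network_sym : symmetric e;
  network_connected : forall i j, connect e i j;
  mixing_sym : W^T = W;
  mixing_ge0 : forall i j, 0 <= W i j;
  mixing_neq0 : forall i j, W i j != 0 <-> e i j \/ i = j;
  mixing_psd : loewner_le 0 W;
  mixing_le1 : loewner_le W 1%:M;
  mixing_row : W *m const_mx 1 = const_mx 1 :> 'cV[R]_m;
  mixing_col : W^T *m const_mx 1 = const_mx 1 :> 'cV[R]_m;
  mixing_null : forall x : 'cV[R]_m,
    (1%:M - W) *m x = 0 <-> exists c : R, x = c *: const_mx 1
}.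

Definition has_expectation {dS : measure_display} {S : measurableType dS}
    {R : realType} (P : probability S R) (X : S -> R) (c : R) : Prop :=
  P.-integrable setT (EFin \o X) /\ 'E_P[X]%E = c%:E.

Definition mutually_independent {dO : measure_display} {Omega : measurableType dO}
    {R : realType} (P : probability Omega R) {J : eqType}
    (E : J -> set (set Omega)) : Prop :=
  forall (s : seq J) (A : J -> set Omega), uniq s ->
    (forall j, j \in s -> E j (A j)) ->
    P (\big[setI/setT]_(j <- s) A j) = (\prod_(j <- s) P (A j))%E.

(* The sigma-algebra generated by a random element. *)
Definition sigma_of {dO dS : measure_display} {Omega : measurableType dO}
    {S : measurableType dS} (X : Omega -> S) : set (set Omega) :=
  preimage_set_system setT X measurable.

(* The sigma-algebras of all the samples [xi i k t] (index [Some (i, k, t)])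
   together with that of the output index [tau] (index [None]). *)
Definition sampling_events {dO : measure_display} {Omega : measurableType dO}
    {m b : nat} {dX : 'I_m -> measure_display}
    {Xi : forall i, measurableType (dX i)}
    (xi : forall i, 'I_b -> nat -> {mfun Omega >-> Xi i})
    (tau : {mfun Omega >-> nat})
    (j : option ('I_m * 'I_b * nat)) : set (set Omega) :=
  match j with
  | Some (i, k, t) => sigma_of (xi i k t)
  | None => sigma_of tau
  end.

(** * The algorithm *)

Section Algorithm.
Context {R : realType} {m d : nat}.

Definition gossip_momentum (W : 'M[R]_m) : R :=
  (1 - Num.sqrt (1 - lambda2 W ^+ 2)) / (1 + Num.sqrt (1 - lambda2 W ^+ 2)).

(* The pair (Y^(k), Y^(k-1)). *)
Fixpoint gossip_pair (Y0 : 'M[R]_(m, d)) (W : 'M[R]_m) (k : nat)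
    : 'M[R]_(m, d) * 'M[R]_(m, d) :=
  match k with
  | 0 => (Y0, Y0)
  | k'.+1 =>
      let: (Y, Yprev) := gossip_pair Y0 W k' in
      ((1 + gossip_momentum W) *: (W *m Y) - gossip_momentum W *: Yprev, Y)
  end.

Definition acc_gossip (Y0 : 'M[R]_(m, d)) (W : 'M[R]_m) (K : nat) : 'M[R]_(m, d) :=
  (gossip_pair Y0 W K).1.

(* The pair (X^t, V^t).  The oracle [G t X] returns the stochastic gradients that
   the round-t samples give at the rows of X, so that G^t = G t X^t. *)
Fixpoint dnsgd (G : nat -> 'M[R]_(m, d) -> 'M[R]_(m, d)) (x0 : 'rV[R]_d)
    (W : 'M[R]_m) (eta : R) (Khat K : nat) (t : nat)
    : 'M[R]_(m, d) * 'M[R]_(m, d) :=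
  match t with
  | 0 => (stack m x0, acc_gossip (G 0 (stack m x0)) W Khat)
  | t'.+1 =>
      let: (X, V) := dnsgd G x0 W eta Khat K t' in
      let X' := acc_gossip (X - eta *: normalize_rows V) W K in
      (X', acc_gossip (V + G t'.+1 X' - G t' X) W K)
  end.

(* The minibatch oracle at the outcome [w]. *)
Definition minibatch {dO : measure_display} {Omega : measurableType dO} {b : nat}
    {dX : 'I_m -> measure_display} {Xi : forall i, measurableType (dX i)}
    (F : forall i, 'rV[R]_d -> Xi i -> R)
    (xi : forall i, 'I_b -> nat -> {mfun Omega >-> Xi i})
    (w : Omega) (t : nat) (X : 'M[R]_(m, d)) : 'M[R]_(m, d) :=
  \matrix_(i < m)
    (b%:R^-1 *: \sum_(k < b) grad (fun x => F i x (xi i k t w)) (row i X)).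

End Algorithm.

(* Main.v *)
From HB Require Import structures.
Require Import Defs.
From mathcomp Require Import all_boot all_order all_algebra.
From mathcomp Require Import all_classical all_reals all_analysis.
From mathcomp Require Import measurable_realfun ring lra.
From mathcomp Require Import complex spectral sesquilinear.

Set Implicit Arguments.
Unset Strict Implicit.
Unset Printing Implicit Defensive.

Import Order.TTheory GRing.Theory Num.Theory.
Import numFieldNormedType.Exports.

Local Open Scope classical_set_scope.
Local Open Scope ring_scope.

(** The gradient norms along the mean models are bounded for every outcome of the
    samples, and expectations are taken only of the resulting inequality, all of
    whose terms are nonnegative.

    Fix an outcome and let [g t] be the gradient of [average f] at the mean model
    of round [t].  Bounded dissimilarity turns the smoothness of the [f i] into local
    Lipschitz continuity of their gradients with the constant [Lf + L1 * frob (g t)]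
    ([grad_lipschitz_local]), within a radius that normalized steps never leave.  In
    the descent inequality ([average_descent]) a normalized step gains
    [eta * frob (g t)] and loses a second-order term and twice [eta] times the mean
    distance from [g t] to the rows of the momentum.  Gossip preserves means, so the
    mean momentum is the mean of the current stochastic gradients; the distance is
    therefore at most the sum of the noise averaged over the network and of the
    consensus errors of the models and of the momenta.  A gossip phase contracts
    consensus errors by a factor of order [m ^- 10] ([acc_gossip_rate]), which beats
    the factors [Num.sqrt m%:R] that relate row norms to Frobenius norms.  The error
    terms that contain [frob (g t)] itself are absorbed into the gain because
    [L1 * eta <= 1 / 2], and summation over the rounds gives [trajectory_bound].

    The contraction rate comes from the spectrum of [W].  Along an eigenvector of
    eigenvalue [l], gossip is a scalar recurrence which is Chebyshev's up to a
    geometric factor ([gossip_poly_chebyshev]), and the eigenvalue 1 is carried by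
    the constant vectors alone ([mixing_frame]).

    For the expectations, the samples of a round are revealed one at a time.  A
    sample independent of what was revealed before can be integrated first
    ([integral_fresh_sample], from Dynkin's theorem and Tonelli's), and its noise is
    then centered, so variances add up ([sample_noise_variance]) and the averaged
    noise has the variance [sigma ^+ 2 / (m * b)] at most.  The same lemma, applied to
    the output index, turns the expectation at the output into the average over the
    rounds ([integral_uniform_index]).  What remains is arithmetic of the parameters
    ([parameter_balance]). *)


(** * Frobenius geometry *)

Section Frobenius.
Context {R : realType} {p q : nat}.
Implicit Types A B : 'M[R]_(p, q).

Definition mdot A B : R := \sum_i \sum_j A i j * B i j.

Lemma mdotC A B : mdot A B = mdot B A.
Proof. by apply: eq_bigr => i _; apply: eq_bigr => j _; rewrite mulrC. Qed.

Lemma mdotDl A B C : mdot (A + B) C = mdot A C + mdot B C.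
Proof.
rewrite -big_split; apply: eq_bigr => i _; rewrite -big_split.
by apply: eq_bigr => j _; rewrite mxE mulrDl.
Qed.

Lemma mdotZl a A B : mdot (a *: A) B = a * mdot A B.
Proof.
rewrite mulr_sumr; apply: eq_bigr => i _; rewrite mulr_sumr.
by apply: eq_bigr => j _; rewrite mxE mulrA.
Qed.

Lemma mdotDr A B C : mdot C (A + B) = mdot C A + mdot C B.
Proof. by rewrite !(mdotC C) mdotDl. Qed.

Lemma mdotZr a A B : mdot A (a *: B) = a * mdot A B.
Proof. by rewrite !(mdotC A) mdotZl. Qed.

Lemma mdot0l A : mdot 0 A = 0.
Proof. by rewrite -(scale0r 0) mdotZl mul0r. Qed.

Lemma mdot0r A : mdot A 0 = 0.
Proof. by rewrite mdotC mdot0l. Qed.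

Lemma frob_ge0 A : 0 <= frob A.
Proof. exact: sqrtr_ge0. Qed.

Lemma sqr_frob A : frob A ^+ 2 = mdot A A.
Proof.
rewrite sqr_sqrtr; last by rewrite sumr_ge0// => i _; rewrite sumr_ge0// => j _; rewrite sqr_ge0.
by apply: eq_bigr => i _; apply: eq_bigr => j _; rewrite expr2.
Qed.

Lemma mdot_ge0 A : 0 <= mdot A A.
Proof. by rewrite -sqr_frob sqr_ge0. Qed.

Lemma frob0 : frob (0 : 'M[R]_(p, q)) = 0.
Proof.
by rewrite /frob big1 ?sqrtr0// => i _; rewrite big1// => j _; rewrite mxE expr0n.
Qed.

Lemma frob_eq0 A : frob A = 0 -> A = 0.
Proof.
move=> A0; have : mdot A A = 0 by rewrite -sqr_frob A0 expr0n.
move/eqP; rewrite psumr_eq0; last first.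
  by move=> i _; rewrite sumr_ge0// => j _; rewrite -expr2 sqr_ge0.
move=> /allP h; apply/matrixP => i j; rewrite mxE.
have := h i (mem_index_enum _); rewrite psumr_eq0; last first.
  by move=> k _; rewrite -expr2 sqr_ge0.
by move=> /allP /(_ j (mem_index_enum _)); rewrite -expr2 sqrf_eq0 => /eqP.
Qed.

Lemma frobZ a A : frob (a *: A) = `|a| * frob A.
Proof.
apply/eqP; rewrite -(@eqrXn2 _ 2)// ?mulr_ge0 ?frob_ge0//.
by rewrite exprMn !sqr_frob mdotZl mdotZr mulrA -expr2 real_normK ?num_real.
Qed.

Lemma frobN A : frob (- A) = frob A.
Proof. by rewrite -scaleN1r frobZ normrN1 mul1r. Qed.

Lemma frobBC A B : frob (A - B) = frob (B - A).
Proof. by rewrite -frobN opprB. Qed.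

(** Cauchy-Schwarz, from the square norm of the component of [A] orthogonal to [B]. *)
Lemma mdot_le_frob A B : mdot A B <= frob A * frob B.
Proof.
have [B0|Bn0] := eqVneq (frob B) 0.
  by rewrite B0 mulr0 (frob_eq0 B0) mdot0r.
have Bp : 0 < frob B by rewrite lt_def Bn0 frob_ge0.
have sqBp : 0 < mdot B B by rewrite -sqr_frob exprn_gt0.
have : 0 <= mdot (A + (- (mdot A B / mdot B B)) *: B)
              (A + (- (mdot A B / mdot B B)) *: B) by exact: mdot_ge0.
rewrite !(mdotDl, mdotDr, mdotZl, mdotZr) (mdotC B A).
set a := mdot A A; set b := mdot B B; set c := mdot A B.
have -> : a + - (c / b) * c + (- (c / b) * c + - (c / b) * (- (c / b) * b))
     = a - c ^+ 2 / b by field; exact: lt0r_neq0.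
rewrite subr_ge0 ler_pdivrMr// /a /b -!sqr_frob -exprMn => h.
apply: le_trans (ler_norm _) _.
by rewrite -(@ler_pXn2r _ 2)// ?nnegrE ?mulr_ge0 ?frob_ge0// real_normK ?num_real.
Qed.

Lemma frobD A B : frob (A + B) <= frob A + frob B.
Proof.
rewrite -(@ler_pXn2r _ 2)// ?nnegrE ?addr_ge0 ?frob_ge0//.
rewrite sqr_frob mdotDl !mdotDr (mdotC B A) sqrrD -!sqr_frob.
have := mdot_le_frob A B; lra.
Qed.

Lemma frobB A B : frob (A - B) <= frob A + frob B.
Proof. by rewrite -(frobN B) frobD. Qed.

Lemma frob_dist B A C : frob (A - C) <= frob (A - B) + frob (B - C).
Proof. by rewrite -[A - C](subrKA B) frobD. Qed.

Lemma frob_sum (I : Type) (r : seq I) (P : pred I) (F : I -> 'M[R]_(p, q)) :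
  frob (\sum_(i <- r | P i) F i) <= \sum_(i <- r | P i) frob (F i).
Proof.
elim/big_rec2: _ => [|i x y _ h]; first by rewrite frob0.
by apply: le_trans (frobD _ _) _; rewrite lerD2l.
Qed.

End Frobenius.

Section Rows.
Context {R : realType} {m d : nat}.
Implicit Types (A B : 'M[R]_(m, d)) (x : 'rV[R]_d).

Lemma mdot_rows A B : mdot A B = \sum_i mdot (row i A) (row i B).
Proof.
apply: eq_bigr => i _; rewrite /mdot big_ord1.
by apply: eq_bigr => j _; rewrite !mxE.
Qed.

Lemma sqr_frob_rows A : frob A ^+ 2 = \sum_i frob (row i A) ^+ 2.
Proof. by rewrite sqr_frob mdot_rows; apply: eq_bigr => i _; rewrite sqr_frob. Qed.

Lemma row_stack x i : row i (stack m x) = x.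
Proof. by apply/rowP => j; rewrite !mxE big_ord1 mxE mul1r. Qed.

Lemma mean_rowE A : mean_row A = m%:R^-1 *: \sum_i row i A.
Proof.
congr (_ *: _); apply/rowP => j; rewrite !mxE summxE.
by apply: eq_bigr => i _; rewrite !mxE mul1r.
Qed.

Lemma mean_rowD A B : mean_row (A + B) = mean_row A + mean_row B.
Proof. by rewrite /mean_row mulmxDr scalerDr. Qed.

Lemma mean_rowZ a A : mean_row (a *: A) = a *: mean_row A.
Proof.
apply/rowP => j; rewrite !mxE mulrCA; congr (_ * _); rewrite mulr_sumr.
by apply: eq_bigr => i _; rewrite !mxE mulrCA.
Qed.

Lemma mean_rowN A : mean_row (- A) = - mean_row A.
Proof. by rewrite -scaleN1r mean_rowZ scaleN1r. Qed.

Lemma stackD x y : stack m (x + y) = stack m x + stack m y.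
Proof. by rewrite /stack mulmxDr. Qed.

Lemma mean_row_stack x : (0 < m)%N -> mean_row (stack m x) = x.
Proof.
move=> m0; rewrite mean_rowE (eq_bigr (fun=> x)); last by move=> i _; rewrite row_stack.
apply/rowP => j; rewrite sumr_const card_ord !mxE mulmxnE -[X in _ * X]mulr_natl mulrA.
by rewrite mulVf ?mul1r// pnatr_eq0 -lt0n.
Qed.

Definition consensus_error A : R := frob (A - stack m (mean_row A)).

Lemma consensus_error_ge0 A : 0 <= consensus_error A.
Proof. exact: frob_ge0. Qed.

Lemma consensus_errorD A B :
  consensus_error (A + B) <= consensus_error A + consensus_error B.
Proof.
rewrite /consensus_error mean_rowD stackD opprD addrACA; exact: frobD.
Qed.

(** Pythagoras: the rows of [A - stack (mean_row A)] sum to zero, hence this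
    matrix is orthogonal to every [stack x]. *)
Lemma consensus_error_le A : (0 < m)%N -> consensus_error A <= frob A.
Proof.
move=> m0; set x := mean_row A.
have m0' : (m%:R : R) != 0 by rewrite pnatr_eq0 -lt0n.
have orth : mdot (A - stack m x) (stack m x) = 0.
  rewrite mdot_rows; transitivity (mdot (\sum_i row i (A - stack m x)) x).
    rewrite [RHS]mdotC; elim/big_rec2: _ => [|i u v _ ->].
      by rewrite mdot0r.
    by rewrite mdotDr row_stack mdotC.
  have -> : \sum_i row i (A - stack m x) = 0.
    have := mean_rowE (A - stack m x).
    rewrite mean_rowD mean_rowN mean_row_stack// subrr => /esym/eqP.
    by rewrite scaler_eq0 invr_eq0 (negbTE m0')/= => /eqP.
  by rewrite mdot0l.
rewrite -(@ler_pXn2r _ 2)// ?nnegrE ?frob_ge0 ?consensus_error_ge0//.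
rewrite !sqr_frob -[X in _ <= mdot X X](subrK (stack m x)).
move: (A - stack m x) orth => D orth.
rewrite [X in _ <= X]mdotDl !mdotDr (mdotC (stack m x)) orth !addr0 add0r.
by rewrite lerDl mdot_ge0.
Qed.

(** Cauchy-Schwarz against the all-ones vector. *)
Lemma sum_frob_row_le A : \sum_i frob (row i A) <= Num.sqrt m%:R * frob A.
Proof.
pose u : 'rV[R]_m := \row_i frob (row i A).
have := mdot_le_frob (const_mx 1) u.
have -> : mdot (const_mx 1) u = \sum_i frob (row i A).
  by rewrite /mdot big_ord1; apply: eq_bigr => i _; rewrite !mxE mul1r.
have -> : frob u = frob A.
  apply/eqP; rewrite -(@eqrXn2 _ 2)// ?frob_ge0//; apply/eqP.
  rewrite sqr_frob /mdot big_ord1 sqr_frob_rows.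
  by apply: eq_bigr => i _; rewrite !mxE expr2.
suff -> : frob (const_mx 1 : 'rV[R]_m) = Num.sqrt m%:R by [].
rewrite /frob big_ord1 (eq_bigr (fun=> 1)); last by move=> j _; rewrite mxE expr1n.
by rewrite sumr_const card_ord.
Qed.

Lemma frob_row_le A i : frob (row i A) <= frob A.
Proof.
rewrite -(@ler_pXn2r _ 2)// ?nnegrE ?frob_ge0// sqr_frob_rows.
by rewrite (bigD1 i)//= lerDl sumr_ge0// => k _; rewrite sqr_ge0.
Qed.

Lemma frob_le_rows A c : 0 <= c -> (forall i, frob (row i A) <= c) ->
  frob A <= Num.sqrt m%:R * c.
Proof.
move=> c0 h; rewrite -(@ler_pXn2r _ 2)// ?nnegrE ?mulr_ge0 ?sqrtr_ge0 ?frob_ge0//.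
rewrite sqr_frob_rows exprMn sqr_sqrtr ?ler0n//.
apply: le_trans (_ : \sum_(i < m) c ^+ 2 <= _); last first.
  by rewrite sumr_const card_ord -[X in X <= _]mulr_natl.
by apply: ler_sum => i _; rewrite ler_pXn2r// ?nnegrE ?frob_ge0.
Qed.

Lemma frob_mean_row_le A c : (0 < m)%N -> (forall i, frob (row i A) <= c) ->
  frob (mean_row A) <= c.
Proof.
move=> m0 h; rewrite mean_rowE frobZ ger0_norm ?invr_ge0 ?ler0n//.
rewrite mulrC ler_pdivrMr ?ltr0n//; apply: le_trans (frob_sum _ _ _) _.
apply: le_trans (_ : \sum_(i < m) c <= _); first by apply: ler_sum => i _.
by rewrite sumr_const card_ord -[X in X <= _]mulr_natr.
Qed.

End Rows.


(** * Spectral frame of a real symmetric matrix *)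

Local Open Scope complex_scope.
Local Open Scope sesquilinear_scope.

Section SpectralFrame.
Context {R : realType} {n : nat}.
Variable W : 'M[R]_n.
Hypothesis Wsym : W^T = W.

Let WC : 'M[R[i]]_n := map_mx (real_complex R) W.

Let WC_herm : WC \is hermsymmx.
Proof.
apply: realsym_hermsym.
  by apply/is_hermitianmxP; rewrite expr0 scale1r map_mx_id// /WC map_trmx Wsym.
by apply/mxOverP => i j; rewrite mxE complex_real.
Qed.

Let P := spectralmx WC.
Let D := spectral_diag WC.

Let WCE : WC = invmx P *m diag_mx D *m P.
Proof. exact/orthomx_spectralP/hermitian_normalmx. Qed.

Let l (i : 'I_n) : R := complex.Re (D 0 i).

Let DE i : D 0 i = (l i)%:C.
Proof.
have /mxOverP/(_ 0 i) := hermitian_spectral_diag_real WC_herm.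
by rewrite -/D /l => /RRe_real.
Qed.

Let char_poly_l : char_poly W = \prod_i ('X - (l i)%:P).
Proof.
have rc_inj : injective (map_poly (real_complex R)) by apply: map_poly_inj.
apply: rc_inj; rewrite map_char_poly -/WC rmorph_prod/=.
transitivity (char_poly (diag_mx D)).
  have PP : map_mx polyC (invmx P) *m map_mx polyC P = 1%:M.
    by rewrite -map_mxM mulVmx ?spectral_unit// map_mx1.
  rewrite /char_poly.
  have -> : char_poly_mx WC = map_mx polyC (invmx P) *m
      char_poly_mx (diag_mx D) *m map_mx polyC P.
    rewrite {1}WCE /char_poly_mx mulmxBr mulmxBl !map_mxM scalar_mxC.
    by rewrite -[X in _ = X - _]mulmxA PP mulmx1.
  by rewrite !det_mulmx mulrAC -det_mulmx PP det1 mul1r.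
rewrite char_poly_trig; last exact: diag_mx_is_trig.
apply: eq_bigr => i _; rewrite mxE eqxx mulr1n DE.
by rewrite rmorphB/= map_polyX map_polyC.
Qed.

Let u (i : 'I_n) : 'rV[R]_n := \row_j complex.Re (P i j).
Let v (i : 'I_n) : 'rV[R]_n := \row_j complex.Im (P i j).

Let Re_mulr (z : R[i]) (a : R) : complex.Re (z * a%:C) = complex.Re z * a.
Proof. by case: z => x y /=; rewrite mulr0 subr0. Qed.

Let Im_mulr (z : R[i]) (a : R) : complex.Im (z * a%:C) = complex.Im z * a.
Proof. by case: z => x y /=; rewrite mulr0 add0r. Qed.

Let PW_row d (A : 'M[R]_(n, d)) i j :
  ((u i *m A) 0 j = complex.Re ((P *m map_mx (real_complex R) A) i j)) *
  ((v i *m A) 0 j = complex.Im ((P *m map_mx (real_complex R) A) i j)).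
Proof.
rewrite !mxE; split.
  rewrite (raddf_sum (@complex.Re R)); apply: eq_bigr => k _.
  by rewrite !mxE -Re_mulr.
rewrite (raddf_sum (@complex.Im R)); apply: eq_bigr => k _.
by rewrite !mxE -Im_mulr.
Qed.

Let PWC : P *m WC = diag_mx D *m P.
Proof. by rewrite {1}WCE !mulmxA mulmxV ?spectral_unit// mul1mx. Qed.

Let eig i : (u i *m W = l i *: u i) * (v i *m W = l i *: v i).
Proof.
split; apply/rowP => j; rewrite PW_row -/WC PWC mul_diag_mx !mxE DE mulrC.
  by rewrite Re_mulr mulrC.
by rewrite Im_mulr mulrC.
Qed.

(* the trace of (P A)^* P A, with P unitary *)
Let parseval d (A : 'M[R]_(n, d)) :
  frob A ^+ 2 = \sum_i (frob (u i *m A) ^+ 2 + frob (v i *m A) ^+ 2).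
Proof.
apply: (@complexI R); set AC := map_mx (real_complex R) A.
have PP : P^t* *m P = 1%:M.
  by rewrite -invmx_unitary ?spectral_unitarymx// mulVmx ?spectral_unit.
have trE q (B : 'M[R[i]]_(q, d)) : \tr (B^t* *m B) = \sum_i \sum_j `|B i j| ^+ 2.
  rewrite /mxtrace exchange_big; apply: eq_bigr => j _; rewrite mxE.
  by apply: eq_bigr => i _; rewrite !mxE mulrC -normCK.
have -> : (frob A ^+ 2)%:C = \tr (AC^t* *m AC).
  rewrite trE sqr_frob rmorph_sum; apply: eq_bigr => i _; rewrite rmorph_sum.
  apply: eq_bigr => j _; rewrite mxE -add_Re2_Im2/= expr0n addr0.
  by rewrite -expr2.
have -> : AC^t* *m AC = (P *m AC)^t* *m (P *m AC).
  rewrite trmx_mul map_mxM mulmxA -[_ *m P]mulmxA PP mulmx1.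
  by [].
rewrite trE rmorph_sum; apply: eq_bigr => i _.
rewrite !sqr_frob /mdot !big_ord1 -big_split rmorph_sum; apply: eq_bigr => j _.
by rewrite -add_Re2_Im2 !PW_row -!expr2.
Qed.

Let orthonormal i j : (mdot (u i) (u j) + mdot (v i) (v j) = (i == j)%:R) /\
                      (mdot (v i) (u j) = mdot (u i) (v j)).
Proof.
have /matrixP/(_ i j) : P *m P^t* = 1%:M.
  by apply/unitarymxP; exact: spectral_unitarymx.
rewrite !mxE => e; have {}e : \sum_k P i k * Num.conj (P j k) = (i == j)%:R :> R[i].
  by rewrite -e; apply: eq_bigr => k _; rewrite !mxE.
have eR := congr1 (@complex.Re R) e; have eI := congr1 (@complex.Im R) e.
rewrite (raddf_sum (@complex.Re R)) in eR; rewrite (raddf_sum (@complex.Im R)) in eI.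
split.
  transitivity (\sum_k complex.Re (P i k * Num.conj (P j k))).
    rewrite /mdot !big_ord1 -big_split; apply: eq_bigr => k _; rewrite !mxE.
    by case: (P i k) => a b; case: (P j k) => a' b' /=; rewrite mulrN opprK.
  by rewrite eR; case: eqP.
apply/eqP; rewrite -subr_eq0; apply/eqP.
transitivity (\sum_k complex.Im (P i k * Num.conj (P j k))).
  rewrite /mdot !big_ord1 -sumrB; apply: eq_bigr => k _; rewrite !mxE.
  by case: (P i k) => a b; case: (P j k) => a' b' /=; rewrite mulrN addrC.
by rewrite eI; case: eqP.
Qed.

(** The vectors [u i] and [v i] are the real and imaginary parts of the rows of a
    unitary matrix over [R[i]] that diagonalizes [W].  They need not be orthogonal,
    but they satisfy Parseval's identity, so they serve as an eigenbasis would.  The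
    last two equations are the real and imaginary parts of the orthonormality of
    the complex rows. *)
Lemma spectral_frame :
  exists (l : 'I_n -> R) (u v : 'I_n -> 'rV[R]_n),
  [/\ char_poly W = \prod_i ('X - (l i)%:P),
      forall i, u i *m W = l i *: u i /\ v i *m W = l i *: v i,
      forall d (A : 'M[R]_(n, d)),
        frob A ^+ 2 = \sum_i (frob (u i *m A) ^+ 2 + frob (v i *m A) ^+ 2) &
      forall i j, mdot (u i) (u j) + mdot (v i) (v j) = (i == j)%:R /\
                  mdot (v i) (u j) = mdot (u i) (v j)].
Proof. by exists l, u, v; split=> // i; rewrite !eig. Qed.

End SpectralFrame.

Local Close Scope sesquilinear_scope.
Local Close Scope complex_scope.


(** * Spectrum of a mixing matrix *)

Section MixingSpectrum.
Context {R : realType}.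

Lemma eigenvalues_perm n (W : 'M[R]_n) (l : 'I_n -> R) :
  char_poly W = \prod_i ('X - (l i)%:P) ->
  sorted >=%R (eigenvalues W) /\ perm_eq (eigenvalues W) [seq l i | i : 'I_n].
Proof.
move=> Wl; rewrite /eigenvalues.
case: xgetP => [s _ [ss Ws]|/(_ (sort >=%R [seq l i | i : 'I_n]))[]].
  split=> //; apply: prod_XsubC_eq.
  by rewrite -Ws Wl big_map big_enum.
split.
  by apply: sort_sorted => x y; exact: le_total.
rewrite Wl -(big_enum _ _ xpredT) -(big_map l xpredT (fun x => 'X - x%:P)).
by apply: perm_big; rewrite perm_sym perm_sort.
Qed.

(** A simple eigenvalue 1 that dominates the others occupies the head of the sorted
    list exactly once, so the next entry bounds all the rest. *)
Lemma second_largest n (W : 'M[R]_n) (l : 'I_n -> R) (i0 : 'I_n) :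
  char_poly W = \prod_i ('X - (l i)%:P) -> (1 < n)%N -> l i0 = 1 ->
  (forall i, i != i0 -> l i < 1) ->
  (exists2 i, i != i0 & lambda2 W = l i) /\
  (forall i, i != i0 -> l i <= lambda2 W).
Proof.
move=> Wl n1 li0 ll; have [ss sl] := eigenvalues_perm Wl.
have sz : size (eigenvalues W) = n.
  by rewrite (perm_size sl) size_map size_enum_ord.
rewrite /lambda2; case: (eigenvalues W) ss sl sz => [|a [|b s]].
- by move=> _ _ /= n0; rewrite -n0 in n1.
- by move=> _ _ /= n0; rewrite -n0 in n1.
rewrite /= => /andP[ba bs] sl _.
have c1 : count_mem 1 [:: a, b & s] = 1%N.
  rewrite (permP sl) count_map (@eq_count _ _ (pred1 i0)); last first.
    move=> i /=; apply/eqP/eqP => [li|->//].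
    by apply/eqP; apply: contraT => /ll; rewrite li ltxx.
  by rewrite count_uniq_mem ?enum_uniq// mem_enum.
have le1 : forall x, x \in [:: a, b & s] -> x <= 1.
  move=> x; rewrite (perm_mem sl) => /mapP[i _ ->].
  by have [->|/ll/ltW//] := eqVneq i i0; rewrite li0.
have lea : forall x, x \in [:: a, b & s] -> x <= a.
  move=> x; rewrite inE => /orP[/eqP->//|].
  have : path >=%R a (b :: s) by rewrite /= ba.
  rewrite path_sortedE; last by move=> ? ? ? /= h1 h2; exact: le_trans h2 h1.
  by move=> /andP[/allP h _] /h.
have a1 : a = 1.
  apply/eqP; rewrite eq_le le1 ?inE ?eqxx//= lea// (perm_mem sl).
  by apply/mapP; exists i0; rewrite ?mem_enum.
have bs1 : 1 \notin b :: s.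
  by move: c1; rewrite a1 -has_pred1 has_count /= eqxx add1n => -[->].
have ble i : i != i0 -> l i <= b.
  move=> ii0; have : l i \in [:: a, b & s].
    by rewrite (perm_mem sl); apply/mapP; exists i; rewrite ?mem_enum.
  rewrite inE a1 lt_eqF ?ll//= inE => /orP[/eqP->//|lis].
  move: bs; rewrite path_sortedE; last by move=> ? ? ? /= h1 h2; exact: le_trans h2 h1.
  by move=> /andP[/allP/(_ _ lis)].
split=> //.
have : b \in [:: a, b & s] by rewrite !inE eqxx orbT.
rewrite (perm_mem sl) => /mapP[i _ bE]; exists i => //.
by apply: contra bs1 => /eqP ii0; rewrite inE bE ii0 li0 eqxx.
Qed.

Lemma mdot_mulmx_tr d (x y : 'rV[R]_d) : (x *m y^T) 0 0 = mdot x y.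
Proof. by rewrite /mdot big_ord1 mxE; apply: eq_bigr => j _; rewrite mxE. Qed.

(** By [mixing_null] an eigenvector for the eigenvalue 1 is constant, and two
    nonzero constant vectors, even complex ones, are not orthogonal; so 1 is a simple
    eigenvalue and every other eigenvalue is at most [lambda2 W < 1]. *)
Lemma mixing_frame n (e : rel 'I_n) (W : 'M[R]_n) :
  mixing_matrix e W -> (1 < n)%N ->
  0 <= lambda2 W < 1 /\
  exists (l : 'I_n -> R) (u v : 'I_n -> 'rV[R]_n),
  [/\ forall i, u i *m W = l i *: u i /\ v i *m W = l i *: v i,
      forall d (A : 'M[R]_(n, d)),
        frob A ^+ 2 = \sum_i (frob (u i *m A) ^+ 2 + frob (v i *m A) ^+ 2) &
      forall i, 0 <= l i <= lambda2 W \/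
        exists a b, u i = const_mx a /\ v i = const_mx b].
Proof.
move=> mixW n1.
have [l [u [v [Wl eig pars orth]]]] := spectral_frame (mixing_sym mixW).
have nrm i : mdot (u i) (u i) + mdot (v i) (v i) = 1.
  by have [-> _] := orth i i; rewrite eqxx.
have quad i : mdot (u i *m W) (u i) + mdot (v i *m W) (v i) = l i.
  by have [-> ->] := eig i; rewrite !mdotZl -mulrDr nrm mulr1.
have l0 i : 0 <= l i.
  have [_ psd] := mixing_psd mixW.
  have := psd (u i)^T; have := psd (v i)^T.
  rewrite subr0 !trmxK !mdot_mulmx_tr -(quad i) => h1 h2.
  exact: addr_ge0.
have l1 i : l i <= 1.
  have [_ psd] := mixing_le1 mixW.
  have := psd (u i)^T; have := psd (v i)^T.
  rewrite !trmxK !mdot_mulmx_tr !mulmxBr !mulmx1.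
  rewrite -[- (u i *m W)]scaleN1r -[- (v i *m W)]scaleN1r.
  rewrite !mdotDl !mdotZl !mulN1r -(quad i) -(nrm i).
  by move=> h1 h2; rewrite -subr_ge0; have := addr_ge0 h2 h1; congr (_ <= _); ring.
have const (x : 'rV[R]_n) : x *m W = x -> exists a, x = const_mx a.
  move=> xW; have [+ _] := mixing_null mixW x^T.
  have -> : (1%:M - W) *m x^T = 0.
    rewrite mulmxBl mul1mx -{1}(mixing_sym mixW) -trmx_mul xW subrr//.
  move=> /(_ erefl)[c xc]; exists c; apply/rowP => j.
  by rewrite -[x]trmxK xc !mxE mulr1.
(* otherwise all frame vectors are orthogonal to the constant vector 1, against
   Parseval *)
have [i0 li0] : exists i, l i = 1.
  apply: contrapT => /forallNP nl.
  have k0 : (0 < n)%N by exact: ltnW.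
  have z i (w : 'rV[R]_n) : w *m W = l i *: w -> w *m (const_mx 1 : 'cV[R]_n) = 0.
    move=> ww; have : w *m W *m (const_mx 1 : 'cV[R]_n) = w *m const_mx 1.
      by rewrite -mulmxA (mixing_row mixW).
    rewrite ww -scalemxAl => /eqP; rewrite -subr_eq0 -[X in _ - X]scale1r.
    rewrite -scalerBl scaler_eq0 subr_eq0 => /orP[/eqP/nl//|/eqP//].
  have := pars _ (const_mx 1 : 'cV[R]_n).
  rewrite big1 => [|i _]; last first.
    have [e1 e2] := eig i.
    by rewrite (z _ _ e1) (z _ _ e2) frob0 expr0n addr0.
  move=> /eqP; rewrite sqrf_eq0 => /eqP/frob_eq0/matrixP/(_ (Ordinal k0) 0).
  by rewrite !mxE => /eqP; rewrite oner_eq0.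
have lt1 i : i != i0 -> l i < 1.
  move=> ii0; rewrite lt_def l1 andbT eq_sym; apply/eqP => li.
  have cst k : l k = 1 -> exists a b, u k = const_mx a /\ v k = const_mx b.
    move=> lk; have [e1 e2] := eig k; rewrite lk !scale1r in e1 e2.
    have [a ua] := const _ e1; have [b vb] := const _ e2.
    by exists a, b.
  have [a [b [ua vb]]] := cst _ li; have [a' [b' [ua' vb']]] := cst _ li0.
  have cc (x y : R) : mdot (const_mx x : 'rV[R]_n) (const_mx y) = n%:R * (x * y).
    rewrite /mdot big_ord1 (eq_bigr (fun=> x * y)) => [|j _]; last by rewrite !mxE.
    by rewrite sumr_const card_ord -[LHS]mulr_natl.
  have := nrm i; have := nrm i0; have [] := orth i i0; rewrite (negbTE ii0).
  rewrite ua vb ua' vb' !cc -!mulrDr.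
  set N : R := n%:R => h1 h2 h3 h4.
  have N0 : N != 0 by rewrite /N pnatr_eq0; case: (n) n1.
  have {}h1 : a * a' + b * b' = 0 by apply: (mulfI N0); rewrite h1 mulr0.
  have {}h2 : b * a' = a * b' by apply: (mulfI N0); rewrite h2.
  (* (a, b) and (a', b') as complex numbers: the product of their square moduli is
     the square modulus of the Hermitian product, which is zero *)
  have : (N * (a * a + b * b)) * (N * (a' * a' + b' * b')) = 0.
    transitivity (N ^+ 2 * ((a * a' + b * b') ^+ 2 + (b * a' - a * b') ^+ 2)).
      by ring.
    by rewrite h1 h2 subrr expr0n addr0 mulr0.
  by rewrite h3 h4 mulr1 => /eqP; rewrite oner_eq0.
have [[i1 i10 l2E] lle] := second_largest Wl n1 li0 lt1.
split; first by rewrite l2E l0 lt1.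
exists l, u, v; split=> // i.
have [->|ii0] := eqVneq i i0; last by left; rewrite l0 lle.
right; have [e1 e2] := eig i0; rewrite li0 !scale1r in e1 e2.
have [a ua] := const _ e1; have [b vb] := const _ e2.
by exists a, b.
Qed.

End MixingSpectrum.


(** * Accelerated gossip *)

Section GossipPolynomial.
Context {R : realType}.
Implicit Types (c e l r s w z : R).

(** The momentum recurrence acting on an eigenvector of [W] for the eigenvalue [l]. *)
Fixpoint gossip_poly e l (k : nat) : R * R :=
  match k with
  | 0 => (1, 1)
  | k'.+1 => let: (p, p') := gossip_poly e l k' in ((1 + e) * l * p - e * p', p)
  end.

(** With [e = r ^+ 2], [(1 + e) * l = 2 * r * c] and [c] in the unit interval, the
    rescaled recurrence is Chebyshev's.  Here [z] is the Chebyshev polynomial of the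
    second kind, [w] its next and [w'] its last increment; the quadratic form
    [w ^+ 2 - 2 * c * w * w' + w' ^+ 2] is conserved, which bounds [w], and [z]
    is the sum of the previous values of [w]. *)
Lemma gossip_poly_chebyshev c r k e l : 0 <= c <= 1 -> e = r ^+ 2 ->
    (1 + e) * l = 2 * r * c ->
  exists w w' z,
  [/\ (gossip_poly e l k).1 = r ^+ k * (w + (1 - r) * z),
      r * (gossip_poly e l k).2 = r ^+ k * (w' + (1 - r) * (z - w')),
      w - w' = (2 * c - 2) * z /\ w ^+ 2 - 2 * c * w * w' + w' ^+ 2 = 2 - 2 * c,
      `|w| <= 2 & `|z| <= 2 * k%:R].
Proof.
move=> /andP[c0 c1] eE lE; elim: k => [|k [w [w' [z [h1 h2 [h3 h4] h5 h6]]]]].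
  exists 1, 1, 0; rewrite /= !expr0 !mulr0 !addr0 normr1 normr0; split; [ring|ring|split; ring|lra|lra].
exists (2 * c * w - w'), w, (z + w).
have h3' : 2 * c * w - w' - w = (2 * c - 2) * (z + w).
  have -> : 2 * c * w - w' - w = (2 * c - 2) * w + (w - w') by ring.
  by rewrite h3; ring.
have h4' : (2 * c * w - w') ^+ 2 - 2 * c * (2 * c * w - w') * w + w ^+ 2 = 2 - 2 * c.
  by rewrite -h4; ring.
move: h1 h2; rewrite /=; case: (gossip_poly e l k) => p p' /= h1 h2; split=> //.
- rewrite lE eE.
  have -> : 2 * r * c * p - r ^+ 2 * p' = r * (2 * c * p - r * p') by ring.
  rewrite h1 h2 exprS.
  have -> : r * (2 * c * (r ^+ k * (w + (1 - r) * z)) -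
     r ^+ k * (w' + (1 - r) * (z - w'))) =
     r * r ^+ k * (2 * c * w - w' + (1 - r) * (2 * c * z - (z - w'))) by ring.
  congr (_ * (_ + _ * _)); apply/eqP; rewrite -subr_eq0; apply/eqP.
  transitivity ((2 * c - 2) * z - (w - w')); first by ring.
  by rewrite h3 subrr.
- by rewrite h1 exprS; ring.
- have [c1'|] := eqVneq c 1.
    have -> : 2 * c * w - w' = w + (w - w') by rewrite c1'; ring.
    by rewrite h3 c1'; have -> : w + (2 * 1 - 2) * z = w by ring.
  move=> cn1; have {cn1} cl1 : c < 1 by rewrite lt_def eq_sym cn1.
  set W := 2 * c * w - w'; rewrite -/W in h4'.
  have : (1 - c) * (1 + c) * W ^+ 2 <= (1 - c) * 2.
    have -> : (1 - c) * 2 = W ^+ 2 - 2 * c * W * w + w ^+ 2 by rewrite h4'; ring.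
    rewrite -subr_ge0.
    have -> : W ^+ 2 - 2 * c * W * w + w ^+ 2 - (1 - c) * (1 + c) * W ^+ 2
      = (c * W - w) ^+ 2 by ring.
    exact: sqr_ge0.
  rewrite -mulrA ler_pM2l ?subr_gt0// => hW.
  rewrite -(@ler_pXn2r _ 2)// ?nnegrE// real_normK ?num_real//.
  have := mulr_ge0 c0 (sqr_ge0 W); nra.
- apply: le_trans (ler_normD _ _) _; rewrite -natr1; lra.
Qed.

(** Here [r = s / (1 + Num.sqrt (1 - s ^+ 2))], and the gap [1 - r] is at least
    [Num.sqrt (1 - s) / 2]: this square root is the acceleration.  Half of the decay
    of [r ^+ k] pays for the linear factor [1 + (1 - r) * k%:R], which comes from the
    double root of the recurrence at [l = s]. *)
Lemma gossip_poly_bound e s l k : 0 <= l <= s -> s < 1 ->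
  e = (1 - Num.sqrt (1 - s ^+ 2)) / (1 + Num.sqrt (1 - s ^+ 2)) ->
  `|(gossip_poly e l k).1| <= 4 * expR (- (Num.sqrt (1 - s) * k%:R / 4)).
Proof.
move=> /andP[l0 ls] s1 eS; pose S := Num.sqrt (1 - s ^+ 2).
have s0 : 0 <= s by exact: le_trans ls.
have S2 : S ^+ 2 = 1 - s ^+ 2 by rewrite sqr_sqrtr//; nra.
have S0 : 0 <= S by exact: sqrtr_ge0.
have S1 : S <= 1.
  by rewrite -(@ler_pXn2r _ 2)// ?nnegrE// S2 expr1n gerBl sqr_ge0.
have nS : 1 + S != 0 by rewrite lt0r_neq0// ltr_wpDr.
pose r := s / (1 + S); pose a := 1 - r.
have eE : e = r ^+ 2.
  rewrite eS -/S /r expr_div_n; apply/eqP.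
  (* S ^+ 2 = 1 - s ^+ 2, so the momentum is a perfect square *)
  have -> : s ^+ 2 = (1 - S) * (1 + S) by rewrite -[s ^+ 2](subKr 1) -S2; ring.
  by apply/eqP; field.
(* c = l / s, and any value serves when s = 0 = l *)
have [c c01 lE] : exists2 c, 0 <= c <= 1 & (1 + e) * l = 2 * r * c.
  have h : (1 + e) * s = 2 * r by rewrite eS -/S /r; field.
  have [s00|sn0] := eqVneq s 0.
    exists 0; rewrite ?lexx ?ler01//; have -> : l = 0 by apply/eqP; rewrite eq_le l0 -s00 ls.
    by rewrite !mulr0.
  exists (l / s); first by rewrite divr_ge0//= ler_pdivrMr ?mul1r// lt_def sn0.
  by rewrite -h; field.
have r0 : 0 <= r by rewrite divr_ge0// addr_ge0.
have r1 : r <= 1 by rewrite ler_pdivrMr ?ltr_wpDr// mul1r; lra.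
have [w [w' [z [-> _ _ w2 z2]]]] := gossip_poly_chebyshev k c01 eE lE.
have aS : Num.sqrt (1 - s) / 2 <= a.
  apply: (@le_trans _ _ (S / 2)).
    rewrite ler_pM2r// ler_sqrt; nra.
  rewrite /a /r -subr_ge0.
  have -> : 1 - s / (1 + S) - S / 2 = (2 * (1 - s) + S * (1 - S)) / (2 * (1 + S)) by field.
  by rewrite divr_ge0 ?mulr_ge0 ?addr_ge0 ?mulr_ge0 ?subr_ge0// ltW.
have a0 : 0 <= a by rewrite subr_ge0.
pose x := a * k%:R.
have x0 : 0 <= x by rewrite mulr_ge0.
rewrite normrM (ger0_norm (exprn_ge0 _ r0)).
have rk : r ^+ k <= expR (- x).
  have -> : expR (- x) = expR (- a) ^+ k by rewrite -expRM_natr mulNr.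
  apply: lerXn2r; rewrite ?nnegrE ?expR_ge0//.
  by apply: le_trans (expR_ge1Dx _); rewrite /a; lra.
have wz : `|w + (1 - r) * z| <= 2 * (1 + x).
  apply: le_trans (ler_normD _ _) _; rewrite normrM (ger0_norm a0).
  have := ler_wpM2l a0 z2; rewrite -/a /x; lra.
have ex : 1 + x <= 2 * expR (x / 2) by have := expR_ge1Dx (x / 2); lra.
apply: (@le_trans _ _ (expR (- x) * (2 * (2 * expR (x / 2))))).
  apply: ler_pM; rewrite ?exprn_ge0//; apply: le_trans wz _; lra.
have -> : expR (- x) * (2 * (2 * expR (x / 2))) = 4 * (expR (- x) * expR (x / 2)) by ring.
rewrite -expRD ler_pM2l// ler_expR.
have := ler_wpM2r (ler0n R k) aS; rewrite /x; lra.
Qed.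

End GossipPolynomial.

Section Gossip.
Context {R : realType} {m d : nat}.
Variables (e : rel 'I_m) (W : 'M[R]_m).
Hypothesis mixW : mixing_matrix e W.
Implicit Types Y : 'M[R]_(m, d).

Lemma mul_mixing_stack (x : 'rV[R]_d) : W *m stack m x = stack m x.
Proof. by rewrite /stack mulmxA (mixing_row mixW). Qed.

Lemma mean_row_mul_mixing Y : mean_row (W *m Y) = mean_row Y.
Proof.
rewrite /mean_row mulmxA; congr (_ *: (_ *m _)).
have := congr1 trmx (mixing_col mixW); rewrite trmx_mul trmxK.
by rewrite trmx_const.
Qed.

(** Gossip is linear and fixes the matrices with equal rows. *)
Lemma gossip_pair_split Y K :
  gossip_pair Y W K =
  ((gossip_pair (Y - stack m (mean_row Y)) W K).1 + stack m (mean_row Y),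
   (gossip_pair (Y - stack m (mean_row Y)) W K).2 + stack m (mean_row Y)).
Proof.
elim: K => [|K IH] /=; first by rewrite subrK.
rewrite IH; case: (gossip_pair _ W K) => A B /=; congr (_, _).
rewrite mulmxDr mul_mixing_stack; apply/matrixP => i j; rewrite !mxE; ring.
Qed.

Lemma mean_row_gossip_pair Y K :
  mean_row (gossip_pair Y W K).1 = mean_row Y /\
  mean_row (gossip_pair Y W K).2 = mean_row Y.
Proof.
elim: K => [//|K [IH1 IH2]] /=; move: IH1 IH2.
case: (gossip_pair _ W K) => A B /= h1 h2; split=> //.
rewrite mean_rowD mean_rowN !mean_rowZ mean_row_mul_mixing h1 h2.
by apply/rowP => j; rewrite !mxE; ring.
Qed.

Lemma mean_row_acc_gossip Y K : mean_row (acc_gossip Y W K) = mean_row Y.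
Proof. by have [] := mean_row_gossip_pair Y K. Qed.

Lemma mul_gossip_pair (u : 'rV[R]_m) l Y K : u *m W = l *: u ->
  u *m (gossip_pair Y W K).1 = (gossip_poly (gossip_momentum W) l K).1 *: (u *m Y) /\
  u *m (gossip_pair Y W K).2 = (gossip_poly (gossip_momentum W) l K).2 *: (u *m Y).
Proof.
move=> uW; elim: K => [|K [IH1 IH2]] /=; first by rewrite scale1r.
move: IH1 IH2; case: (gossip_pair _ W K) => A B; case: (gossip_poly _ _ K) => p q /=.
move=> h1 h2; split=> //.
rewrite mulmxBr -!scalemxAr mulmxA uW -scalemxAl h1 h2.
by apply/rowP => j; rewrite !mxE; ring.
Qed.

Lemma frob_acc_gossip_le Y K : (1 < m)%N -> mean_row Y = 0 ->
  frob (acc_gossip Y W K) <=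
  4 * expR (- (Num.sqrt (1 - lambda2 W) * K%:R / 4)) * frob Y.
Proof.
move=> m1 Y0; have [/andP[l20 l21] [l [u [v [eig pars dich]]]]] := mixing_frame mixW m1.
set rho := 4 * _.
have rho0 : 0 <= rho by rewrite mulr_ge0// expR_ge0.
rewrite -(@ler_pXn2r _ 2)// ?nnegrE ?mulr_ge0 ?frob_ge0// exprMn !pars mulr_sumr.
apply: ler_sum => i _; have [eu ev] := eig i.
have cst a : (const_mx a : 'rV[R]_m) *m Y = 0.
  have m0 : (m%:R : R) != 0 by rewrite pnatr_eq0; case: (m) m1.
  have -> : const_mx a = a *: const_mx 1 :> 'rV[R]_m.
    by apply/rowP => j; rewrite !mxE mulr1.
  move: Y0 => /eqP; rewrite scaler_eq0 invr_eq0 (negbTE m0)/= -scalemxAl => /eqP ->.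
  by rewrite scaler0.
have [-> _] := mul_gossip_pair Y K eu; have [-> _] := mul_gossip_pair Y K ev.
case: (dich i) => [li|[a [b [-> ->]]]]; last first.
  by rewrite !cst scaler0 frob0 !expr0n/= addr0 mulr0.
have pb := gossip_poly_bound K li l21 (erefl (gossip_momentum W)); rewrite -/rho in pb.
rewrite !frobZ !exprMn -mulrDr ler_wpM2r ?addr_ge0 ?sqr_ge0//.
by rewrite -exprMn ler_pXn2r// nnegrE.
Qed.

Lemma consensus_error_acc_gossip Y K rho :
  (forall Z : 'M[R]_(m, d), mean_row Z = 0 -> frob (acc_gossip Z W K) <= rho * frob Z) ->
  (0 < m)%N ->
  consensus_error (acc_gossip Y W K) <= rho * consensus_error Y.
Proof.
move=> h m0; rewrite /consensus_error mean_row_acc_gossip {1}/acc_gossip.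
rewrite gossip_pair_split /= addrK; apply: h.
by rewrite mean_rowD mean_rowN mean_row_stack// subrr.
Qed.

End Gossip.

(** The number of rounds pushes the factor [4 * expR _] of [frob_acc_gossip_le] below
    [4 * Num.sqrt m%:R ^- 20]; as [Num.sqrt m%:R ^+ 19 >= 2 ^+ 9], this is small even
    after a multiplication by [Num.sqrt m%:R].  A single agent has no consensus error. *)
Lemma acc_gossip_rate {R : realType} (m : nat) (e : rel 'I_m) (W : 'M[R]_m) (eta : R) K :
  (0 < m)%N -> mixing_matrix e W -> 0 <= eta ->
  K%:Z = Num.ceil (80 * ln (Num.sqrt m%:R * (1 + eta)) / Num.sqrt (1 - lambda2 W)) ->
  exists rho : R, [/\ 0 <= rho, rho * Num.sqrt m%:R <= 1 / 100 &
    forall d (Y : 'M[R]_(m, d)),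
      consensus_error (acc_gossip Y W K) <= rho * consensus_error Y].
Proof.
move=> m0 mixW eta0 KE; have [m1|m1] := ltnP 1 m; last first.
  exists 0; rewrite mul0r; split=> // d Y.
  have -> : consensus_error (acc_gossip Y W K) = 0; last by rewrite mul0r.
  have {}m1 : m = 1 by apply/eqP; rewrite eqn_leq m1.
  rewrite /consensus_error; move: (acc_gossip Y W K) => {}Y {KE mixW}; subst m.
  suff -> : stack 1 (mean_row Y) = Y by rewrite subrr frob0.
  by apply/matrixP => i j; rewrite ord1 !mxE big_ord1 !mxE big_ord1 mxE invr1 !mul1r.
have [/andP[l20 l21] _] := mixing_frame mixW m1.
pose x : R := Num.sqrt m%:R; pose g := Num.sqrt (1 - lambda2 W).
have g0 : 0 < g by rewrite sqrtr_gt0 subr_gt0.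
have x2 : 2 <= x ^+ 2 by rewrite sqr_sqrtr ?ler0n// ler_nat.
have x0 : 0 < x by rewrite sqrtr_gt0 ltr0n.
have x1 : 1 <= x by rewrite -(@ler_pXn2r _ 2)// ?nnegrE ?ltW// expr1n; lra.
pose rho := 4 * expR (- (g * K%:R / 4)).
exists rho; split.
- by rewrite mulr_ge0// expR_ge0.
- have Kge : 80 * ln x / g <= K%:R.
    have : 80 * ln (x * (1 + eta)) / g <= K%:R.
      by apply: le_trans (ceil_ge _) _; rewrite -KE.
    apply: le_trans; rewrite ler_pM2r ?invr_gt0// ler_pM2l// ler_ln ?posrE//.
      by apply: ler_peMr; [exact: ltW|lra].
    by rewrite mulr_gt0// ltr_wpDr.
  have rhoE : rho <= 4 * x ^- 20.
    rewrite ler_pM2l// -[x ^- 20]lnK ?posrE ?invr_gt0 ?exprn_gt0//.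
    rewrite ler_expR lnV ?posrE ?exprn_gt0// lnXn// lerN2.
    move: Kge; rewrite ler_pdivrMr// -[ln x *+ 20]mulr_natl; lra.
  rewrite -/x; apply: le_trans (ler_wpM2r (ltW x0) rhoE) _.
  have x19 : 400 <= x ^+ 19.
    rewrite exprS (_ : 18 = 2 * 9)%N// exprM.
    have : (2 : R) ^+ 9 <= (x ^+ 2) ^+ 9 by apply: lerXn2r; rewrite ?nnegrE// exprn_ge0// ltW.
    have -> : (2 : R) ^+ 9 = 512 by ring.
    move=> h; apply: le_trans (_ : 1 * 512 <= _); first by lra.
    exact: (ler_pM ler01 (ler0n R 512) x1 h).
  have -> : 4 * x ^- 20 * x = 4 / x ^+ 19.
    by rewrite [x ^+ 20]exprS; move: (x ^+ 19) (exprn_gt0 19 x0) => y y0; field; rewrite !gt_eqF.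
  rewrite ler_pdivrMr ?exprn_gt0//; lra.
move=> d Y; apply: (consensus_error_acc_gossip mixW) => // Z Z0.
exact: (frob_acc_gossip_le mixW).
Qed.


(** * Relaxed smoothness and descent *)

Section Gradient.
Context {R : realType} {d : nat}.
Implicit Types (f : 'rV[R]_d -> R) (x y h : 'rV[R]_d).

Lemma derive_grad f x h : differentiable f x -> 'D_h f x = mdot (grad f x) h.
Proof.
move=> fx; rewrite deriveE// {1}[h]row_sum_delta linear_sum /mdot big_ord1.
by apply: eq_bigr => j _; rewrite linearZ /= -deriveE// !mxE mulrC.
Qed.

(** The difference quotients of the line function at [t] are those of [f] at the
    point of parameter [t]. *)
Lemma is_derive_line f x h (t : R) : differentiable f (x + t *: h) ->
  is_derive t 1 (fun s : R => f (x + s *: h)) (mdot (grad f (x + t *: h)) h).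
Proof.
move=> fx; rewrite -derive_grad//.
have E : (fun e : R => e^-1 *: (((fun s : R => f (x + s *: h)) \o shift t) (e *: 1)
            - f (x + t *: h))) =
   (fun e : R => e^-1 *: ((f \o shift (x + t *: h)) (e *: h) - f (x + t *: h))).
  apply/funext => e /=; congr (_ *: (f _ - _)).
  by apply/rowP => j; rewrite !mxE scaler1; ring.
split.
  by rewrite /derivable E; exact: diff_derivable.
by rewrite /derive E.
Qed.

(** Along the segment, [f] minus its tangent and minus the quadratic term has
    nonpositive derivative. *)
Lemma descent_lemma f x y (A : R) : (forall z, differentiable f z) ->
  (forall t : R, 0 <= t <= 1 ->
     frob (grad f (x + t *: (y - x)) - grad f x) <= A * (t * frob (y - x))) ->
  f y <= f x + mdot (grad f x) (y - x) + A * frob (y - x) ^+ 2 / 2.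
Proof.
move=> df gA; set h := y - x; set c := mdot (grad f x) h; set B := A * frob h ^+ 2.
pose psi (s : R) := f (x + s *: h) - (c * s + B / 2 * s ^+ 2).
pose dpsi (s : R) := mdot (grad f (x + s *: h)) h - (c + B * s).
have dps (s : R) : is_derive s (1 : R) psi (dpsi s).
  apply: is_deriveB; first exact: is_derive_line.
  apply: is_derive_eq; rewrite /GRing.scale /= !mulr1 ?expr1; lra.
have [|t t01] := @MVT R psi dpsi 0 1 ltr01 (fun s _ => dps s).
  by apply: derivable_within_continuous => s _; have [] := dps s.
rewrite subr0 mulr1 => pt.
have t01' : 0 <= t <= 1 by move: t01; rewrite in_itv /= => /andP[/ltW-> /ltW->].
have : dpsi t <= 0.
  have := mdot_le_frob (grad f (x + t *: h) - grad f x) h.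
  have := ler_wpM2r (frob_ge0 h) (gA t t01').
  rewrite mdotDl -[- grad f x]scaleN1r mdotZl -/c /dpsi /B -/h scaleN1r; lra.
rewrite -pt /psi scale1r scale0r addr0 /h subrKC; lra.
Qed.

End Gradient.

Section Average.
Context {R : realType} {m d : nat}.
Variable f : 'I_m -> 'rV[R]_d -> R.
Hypothesis m0 : (0 < m)%N.
Hypothesis df : forall i x, differentiable (f i) x.

Let averageE : average f = m%:R^-1 *: \sum_i f i.
Proof. apply/funext => x; rewrite /average /GRing.scale /=; congr (_ * _).
by rewrite fct_sumE. Qed.

Lemma differentiable_average x : differentiable (average f) x.
Proof.
rewrite averageE; apply: differentiableZ; apply: differentiable_sum => i; exact: df.
Qed.

Lemma grad_average x : grad (average f) x = m%:R^-1 *: \sum_i grad (f i) x.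
Proof.
apply/rowP => j; rewrite !mxE averageE deriveZ; last first.
  by apply: derivable_sum => i; exact: diff_derivable.
rewrite derive_sum; last by move=> i; exact: diff_derivable.
by rewrite summxE; congr (_ * _); apply: eq_bigr => i _; rewrite mxE.
Qed.

Context {L0 L1 zeta : R}.
Hypothesis L1_ge0 : 0 <= L1.
Hypothesis smooth : forall i, L0L1_smooth L0 L1 (f i).
Hypothesis diss : forall i x, frob (grad (f i) x - grad (average f) x) <= zeta.

Let Lf := L0 + L1 * zeta.

(** The local constant is measured by the gradient of [average f] instead of that of
    [f i]; they differ by at most [zeta], which is absorbed into [Lf]. *)
Lemma grad_lipschitz_local i x y : L1 * frob (x - y) <= 1 ->
  frob (grad (f i) x - grad (f i) y) <=
  (Lf + L1 * frob (grad (average f) x)) * frob (x - y).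
Proof.
move=> xy; apply: (le_trans (smooth i _)).
  rewrite inver; case: eqP => [_|/eqP L1n0]; first exact: leey.
  by rewrite lee_fin -[_^-1]mul1r ler_pdivlMr 1?mulrC// lt_def L1n0.
rewrite ler_wpM2r ?frob_ge0// /Lf -addrA lerD2l -mulrDr ler_wpM2l//.
have := frobD (grad (f i) x - grad (average f) x) (grad (average f) x).
by rewrite subrK => /le_trans; apply; rewrite lerD2r.
Qed.

Lemma grad_average_lipschitz_local x y : L1 * frob (x - y) <= 1 ->
  frob (grad (average f) x - grad (average f) y) <=
  (Lf + L1 * frob (grad (average f) x)) * frob (x - y).
Proof.
move=> xy.
pose A := \matrix_(i < m) (grad (f i) x - grad (f i) y).
have -> : grad (average f) x - grad (average f) y = mean_row A.
  rewrite mean_rowE !grad_average -scalerBr -sumrB; congr (_ *: _).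
  by apply: eq_bigr => i _; rewrite rowK.
by apply: frob_mean_row_le => // i; rewrite rowK; exact: grad_lipschitz_local.
Qed.

Lemma average_descent x y : L1 * frob (x - y) <= 1 ->
  average f y <= average f x + mdot (grad (average f) x) (y - x) +
    (Lf + L1 * frob (grad (average f) x)) * frob (y - x) ^+ 2 / 2.
Proof.
move=> xy; apply: descent_lemma => [z|t /andP[t0 t1]]; first exact: differentiable_average.
have e : frob (x - (x + t *: (y - x))) = t * frob (y - x).
  by rewrite opprD addNKr frobN frobZ ger0_norm.
rewrite frobBC -e; apply: grad_average_lipschitz_local; rewrite e.
by apply: le_trans xy; rewrite (frobBC x) ler_wpM2l// ler_piMl ?frob_ge0.
Qed.

End Average.


(** * The trajectory for a fixed outcome *)

Section Trajectory.
Context {R : realType} {m d : nat}.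
Variables (f : 'I_m -> 'rV[R]_d -> R) (L0 L1 zeta Lf eta rho sm finf : R).
Variables (W : 'M[R]_m) (e : rel 'I_m) (K Khat : nat).
Variables (G : nat -> 'M[R]_(m, d) -> 'M[R]_(m, d)) (x0 : 'rV[R]_d).
Hypothesis LfE : Lf = L0 + L1 * zeta.
Hypothesis sm_def : sm = Num.sqrt m%:R.
Hypothesis m0 : (0 < m)%N.
Hypothesis df : forall i x, differentiable (f i) x.
Hypothesis L1_ge0 : 0 <= L1.
Hypothesis smooth : forall i, L0L1_smooth L0 L1 (f i).
Hypothesis diss : forall i x, frob (grad (f i) x - grad (average f) x) <= zeta.
Hypothesis Lf_ge0 : 0 <= Lf.
Hypothesis finfP : forall x, finf <= average f x.
Hypothesis mixW : mixing_matrix e W.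
Hypothesis eta_ge0 : 0 <= eta.
Hypothesis L1eta : L1 * eta <= 1 / 2.
Hypothesis rho_ge0 : 0 <= rho.
Hypothesis rho_small : rho * sm <= 1 / 100.
Hypothesis gossip_rho : forall Y : 'M[R]_(m, d),
  consensus_error (acc_gossip Y W K) <= rho * consensus_error Y.

Definition grad_rows (X : 'M[R]_(m, d)) : 'M[R]_(m, d) :=
  \matrix_(i < m) grad (f i) (row i X).

Let X t := (dnsgd G x0 W eta Khat K t).1.
Let V t := (dnsgd G x0 W eta Khat K t).2.
Let xbar t := mean_row (X t).
Let g t := grad (average f) (xbar t).
Let noise t := G t (X t) - grad_rows (X t).
Let S t := consensus_error (V t).
Let A t := Lf + L1 * frob (g t).
Let sm1 : 1 <= sm.
Proof. by rewrite sm_def -[X in X <= _]sqrtr1 ler_sqrt ?ler1n. Qed.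

Let sm0 : 0 < sm. Proof. exact: lt_le_trans sm1. Qed.

Let rho1 : rho <= 1 / 100.
Proof. by apply: le_trans rho_small; apply: ler_peMr. Qed.

Let mR0 : (0 : R) < m%:R. Proof. by rewrite ltr0n. Qed.

Let smE : sm * sm = m%:R.
Proof. by rewrite sm_def -expr2 sqr_sqrtr// ler0n. Qed.

Let XS t : X t.+1 = acc_gossip (X t - eta *: normalize_rows (V t)) W K.
Proof. by rewrite /X /V /=; case: dnsgd. Qed.

Let VS t : V t.+1 = acc_gossip (V t + G t.+1 (X t.+1) - G t (X t)) W K.
Proof. by rewrite /X /V /=; case: dnsgd. Qed.

(** Gossip preserves means, so the average of the local momenta tracks the average
    of the current stochastic gradients. *)
Let mean_V t : mean_row (V t) = mean_row (G t (X t)).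
Proof.
elim: t => [|t IH]; first by rewrite /V /X /= (mean_row_acc_gossip mixW).
by rewrite VS (mean_row_acc_gossip mixW) !mean_rowD mean_rowN IH addrC addKr.
Qed.

Let A_ge0 t : 0 <= A t.
Proof. by rewrite addr_ge0// mulr_ge0// frob_ge0. Qed.

Let norm_row_le1 (B : 'M[R]_(m, d)) i : frob (row i (normalize_rows B)) <= 1.
Proof.
rewrite rowK frobZ ger0_norm ?invr_ge0 ?frob_ge0//.
by have [->|n0] := eqVneq (frob (row i B)) 0; rewrite ?mulr0// mulVf.
Qed.

Let frob_normalize (B : 'M[R]_(m, d)) : frob (normalize_rows B) <= sm.
Proof. by rewrite -[sm]mulr1 sm_def; exact: frob_le_rows. Qed.

(** The bound [eta / 50] is preserved by [c |-> rho * (c + eta * sm)], the effect of a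
    round on the consensus error of the models. *)
Let consensus_X t : consensus_error (X t) <= eta / 50.
Proof.
elim: t => [|t IH].
  by rewrite /consensus_error /X /= mean_row_stack// subrr frob0 divr_ge0.
rewrite XS; have := gossip_rho (X t - eta *: normalize_rows (V t)).
have h : consensus_error (X t - eta *: normalize_rows (V t)) <=
    consensus_error (X t) + eta * sm.
  apply: le_trans (consensus_errorD _ _) _; rewrite lerD2l.
  apply: le_trans (consensus_error_le _ m0) _.
  by rewrite frobN frobZ ger0_norm// ler_wpM2l.
have := ler_wpM2l rho_ge0 h; have := ler_wpM2l rho_ge0 IH.
have := ler_wpM2l eta_ge0 rho_small; have := ler_wpM2l eta_ge0 rho1; move: eta_ge0 L1eta; lra.
Qed.

Let row_X t i : frob (row i (X t) - xbar t) <= eta / 50.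
Proof.
apply: le_trans (consensus_X t).
have := frob_row_le (X t - stack m (xbar t)) i.
by rewrite linearB /= row_stack.
Qed.

Let step t : exists2 ubar : 'rV[R]_d, xbar t.+1 = xbar t - eta *: ubar &
  frob ubar <= 1 /\ mdot (g t) ubar = m%:R^-1 * \sum_i mdot (g t) (row i (normalize_rows (V t))).
Proof.
exists (mean_row (normalize_rows (V t))).
  by rewrite /xbar XS (mean_row_acc_gossip mixW) mean_rowD mean_rowN mean_rowZ.
split; first exact: frob_mean_row_le.
rewrite mean_rowE mdotZr; congr (_ * _).
by elim/big_rec2: _ => [|i y1 y2 _ <-]; rewrite ?mdot0r// mdotDr.
Qed.

(** [frob v] is the inner product of [v] with its direction; replacing [v] by [x] costs
    [frob (x - v)] twice, once in the inner product and once in the norm. *)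
Let align (x v : 'rV[R]_d) : frob x - 2 * frob (x - v) <= mdot x ((frob v)^-1 *: v).
Proof.
have [v0|vn0] := eqVneq (frob v) 0.
  rewrite (frob_eq0 v0) subr0 scaler0 mdot0r; have := frob_ge0 x; move: eta_ge0 L1eta; lra.
have v1 : mdot v ((frob v)^-1 *: v) = frob v.
  by rewrite mdotZr -sqr_frob expr2 mulKf.
have u1 : frob ((frob v)^-1 *: v) = 1.
  by rewrite frobZ ger0_norm ?invr_ge0 ?frob_ge0// mulVf.
have := mdot_le_frob (v - x) ((frob v)^-1 *: v).
rewrite mdotDl -[- x]scaleN1r mdotZl scaleN1r v1 u1 (frobBC v).
have := frobD (x - v) v; rewrite subrK; move: eta_ge0 L1eta; lra.
Qed.

Let grad_error t :
  frob (g t - mean_row (V t)) <= A t * (eta / 50) + frob (mean_row (noise t)).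
Proof.
have -> : g t - mean_row (V t) =
    mean_row (grad_rows (stack m (xbar t)) - grad_rows (X t)) - mean_row (noise t).
  rewrite mean_V /noise !mean_rowD !mean_rowN.
  have -> : g t = mean_row (grad_rows (stack m (xbar t))).
    rewrite mean_rowE /g grad_average//; congr (_ *: _).
    by apply: eq_bigr => i _; rewrite rowK row_stack.
  by rewrite [mean_row (G _ _) + _]addrC opprD opprK addrA subrK.
apply: le_trans (frobB _ _) _; rewrite lerD2r.
apply: frob_mean_row_le => // i; rewrite linearB /= !rowK row_stack.
have ri := row_X t i.
apply: le_trans (grad_lipschitz_local L1_ge0 smooth diss _ _) _.
  rewrite frobBC; have := ler_wpM2l L1_ge0 ri; move: eta_ge0 L1eta; lra.
by rewrite frobBC -LfE ler_wpM2l// A_ge0.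
Qed.

(** A step moves the mean model by at most [eta], so [average_descent] applies. *)
Let one_step t : average f (xbar t.+1) <= average f (xbar t) - eta * frob (g t) +
  2 * eta * (A t * (eta / 50) + frob (mean_row (noise t)) + S t / sm) +
  A t * eta ^+ 2 / 2.
Proof.
have [ubar xb [u1 gu]] := step t.
have dist : frob (xbar t.+1 - xbar t) <= eta.
  by rewrite xb addrC addKr frobN frobZ ger0_norm// ler_piMr.
have := @average_descent R m d f m0 df L0 L1 zeta L1_ge0 smooth diss (xbar t) (xbar t.+1).
have dist' : L1 * frob (xbar t - xbar t.+1) <= 1.
  rewrite frobBC; have := ler_wpM2l L1_ge0 dist; move: eta_ge0 L1eta; lra.
move=> /(_ dist') h; apply: le_trans h _.
have q : A t * frob (xbar t.+1 - xbar t) ^+ 2 / 2 <= A t * eta ^+ 2 / 2.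
  by rewrite ler_pM2r// ler_wpM2l// ler_pXn2r// nnegrE frob_ge0.
rewrite -/(g t) -LfE -/(A t).
have lin : mdot (g t) (xbar t.+1 - xbar t) = - eta * mdot (g t) ubar.
  by rewrite xb addrC addKr -scaleNr mdotZr.
rewrite lin; apply: (@le_trans _ _ (average f (xbar t) + - eta * mdot (g t) ubar + A t * eta ^+ 2 / 2)).
  by rewrite lerD2l.
rewrite lerD2r -addrA -addrA lerD2l.
suff : frob (g t) - 2 * (A t * (eta / 50) + frob (mean_row (noise t)) + S t / sm)
    <= mdot (g t) ubar.
  by move=> /(ler_wpM2l eta_ge0); move: eta_ge0 L1eta; lra.
have rows : \sum_i frob (g t - row i (V t)) <= m%:R * frob (g t - mean_row (V t)) + sm * S t.
  apply: (@le_trans _ _ (\sum_i (frob (g t - mean_row (V t)) +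
      frob (row i (V t - stack m (mean_row (V t))))))).
    apply: ler_sum => i _; apply: le_trans (frob_dist (mean_row (V t)) _ _) _.
    by rewrite lerD2l linearB /= row_stack frobBC.
  rewrite big_split sumr_const card_ord /= -[X in X + _ <= _]mulr_natl lerD2l.
  by rewrite sm_def; exact: sum_frob_row_le.
have ge := grad_error t.
rewrite gu [X in _ <= X]mulrC ler_pdivlMr//.
apply: (@le_trans _ _ (\sum_i (frob (g t) - 2 * frob (g t - row i (V t))))); last first.
  by apply: ler_sum => i _; rewrite rowK; exact: align.
rewrite sumrB sumr_const card_ord -mulr_sumr -[X in _ <= X - _]mulr_natl.
have e1 : S t / sm * m%:R = sm * S t by rewrite -smE; field; exact: lt0r_neq0.
have := ler_wpM2l (ltW mR0) ge; move: eta_ge0 L1eta; lra.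
Qed.

(** The mean model moves by at most [eta], and the local models stay within [eta / 50]
    of it before and after. *)
Let drift t : frob (grad_rows (X t.+1) - grad_rows (X t)) <= sm * (2 * eta * A t).
Proof.
have c0 : 0 <= 2 * eta * A t by rewrite !mulr_ge0// A_ge0.
rewrite sm_def; apply: frob_le_rows => // i; rewrite linearB /= !rowK.
have [ubar xb [u1 _]] := step t.
have ri := row_X t i; have ri' := row_X t.+1 i.
have dist : frob (row i (X t.+1) - xbar t) <= eta + eta / 50.
  apply: le_trans (frob_dist (xbar t.+1) _ _) _; rewrite addrC; apply: lerD => //.
  by rewrite xb addrC addKr frobN frobZ ger0_norm// ler_piMr.
have lip z (a : R) : frob (z - xbar t) <= a -> a <= 2 * eta ->
    frob (grad (f i) (xbar t) - grad (f i) z) <= A t * a.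
  move=> za a2; apply: le_trans (grad_lipschitz_local L1_ge0 smooth diss _ _) _.
    rewrite frobBC; have := ler_wpM2l L1_ge0 za; have := ler_wpM2l L1_ge0 a2; move: eta_ge0 L1eta; lra.
  by rewrite frobBC -LfE ler_wpM2l// A_ge0.
have l1 := lip _ _ ri; have l2 := lip _ _ dist.
have {}l1 : frob (grad (f i) (xbar t) - grad (f i) (row i (X t))) <= A t * (eta / 50).
  by apply: l1; move: eta_ge0 L1eta; lra.
have {}l2 : frob (grad (f i) (xbar t) - grad (f i) (row i (X t.+1))) <= A t * (eta + eta / 50).
  by apply: l2; move: eta_ge0 L1eta; lra.
apply: le_trans (frob_dist (grad (f i) (xbar t)) _ _) _.
rewrite (frobBC (grad (f i) (row i (X t.+1)))).
have := mulr_ge0 (A_ge0 t) eta_ge0; move: l1 l2.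
move: (frob _) (frob _) (A t) => a c At; lra.
Qed.

Let consensus_V t : S t.+1 <=
  rho * (S t + frob (noise t) + frob (noise t.+1) + 2 * sm * eta * A t).
Proof.
rewrite /S VS; apply: le_trans (gossip_rho _) _; rewrite ler_wpM2l//.
rewrite -addrA; apply: le_trans (consensus_errorD _ _) _.
rewrite -!addrA lerD2l; apply: le_trans (consensus_error_le _ m0) _.
have -> : G t.+1 (X t.+1) - G t (X t) = - noise t + (noise t.+1 +
    (grad_rows (X t.+1) - grad_rows (X t))).
  by rewrite /noise; apply/matrixP => i j; rewrite !mxE; ring.
apply: le_trans (frobD _ _) _; rewrite frobN lerD2l.
apply: le_trans (frobD _ _) _; rewrite lerD2l.
apply: le_trans (drift t) _; move: eta_ge0 L1eta; lra.
Qed.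

(** In the step from [n] to [n.+1] both sides grow by the two sides of [consensus_V]. *)
Let sum_S n : (1 - rho) * (\sum_(t < n) S t) + S n <= S 0 +
  rho * (2 * (\sum_(t < n) frob (noise t)) + frob (noise n)
         + 2 * sm * eta * \sum_(t < n) A t).
Proof.
elim: n => [|n IH].
  by rewrite !big_ord0 !mulr0 add0r addr0 add0r lerDl mulr_ge0// frob_ge0.
rewrite !big_ord_recr /=; have := consensus_V n.
move: (\sum_(t < n) S t) (\sum_(t < n) frob (noise t)) (\sum_(t < n) A t) IH.
move: (S 0) (S n) (S n.+1) (A n) (frob (noise n)) (frob (noise n.+1)).
move=> s0 s s' a b b' Ss Ms As; lra.
Qed.

Let sum_descent n : eta * (\sum_(t < n) frob (g t)) <=
  average f x0 - average f (xbar n) +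
  2 * eta * ((\sum_(t < n) A t) * (eta / 50) +
             (\sum_(t < n) frob (mean_row (noise t))) + (\sum_(t < n) S t) / sm) +
  (\sum_(t < n) A t) * eta ^+ 2 / 2.
Proof.
elim: n => [|n IH].
  rewrite !big_ord0 !mul0r !addr0 !mulr0 !addr0 /xbar /X /= mean_row_stack//.
  by rewrite subrr.
by rewrite !big_ord_recr /=; have := one_step n; move: eta_ge0 L1eta; lra.
Qed.

(** Summing the descent inequality over the rounds.  The consensus errors feed back
    only with the small factor [rho], and the terms in which the gradient norm itself
    occurs are absorbed by [L1 * eta <= 1 / 2]. *)
Lemma trajectory_bound T : (0 < T)%N ->
  7 / 10 * eta * (\sum_(t < T) frob (g t)) <=
  average f x0 - finf + 203 / 100 * eta / sm * S 0 + 3 / 5 * eta ^+ 2 * Lf * T%:R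
  + 2 * eta * (\sum_(t < T) frob (mean_row (noise t)))
  + 1 / 20 * eta / m%:R * (\sum_(t < T) frob (noise t)).
Proof.
move=> T0; have hd := sum_descent T; have hf := finfP (xbar T).
have hA : \sum_(t < T) A t = T%:R * Lf + L1 * \sum_(t < T) frob (g t).
  rewrite big_split /= mulr_sumr sumr_const card_ord.
  by rewrite -[X in X + _ = _]mulr_natl.
have hS : (1 - rho) * (\sum_(t < T) S t) <= S 0 +
    rho * (2 * (\sum_(t < T) frob (noise t)) + 2 * sm * eta * \sum_(t < T) A t).
  case: (T) T0 => // n _; have h := sum_S n.
  have S0 : 0 <= S n by exact: consensus_error_ge0.
  have rS : 0 <= rho * S n by exact: mulr_ge0.
  have N0 : 0 <= rho * frob (noise n) by rewrite mulr_ge0// frob_ge0.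
  have A0 : 0 <= rho * (sm * eta * A n) by rewrite !mulr_ge0// ?A_ge0// ltW.
  rewrite !big_ord_recr /=; move: eta_ge0 L1eta; lra.
move: hd hS; rewrite hA.
have N0 : 0 <= \sum_(t < T) frob (noise t) by rewrite sumr_ge0// => i _; exact: frob_ge0.
have g0 : 0 <= \sum_(t < T) frob (g t) by rewrite sumr_ge0// => i _; exact: frob_ge0.
have SS0 : 0 <= \sum_(t < T) S t by rewrite sumr_ge0// => i _; exact: frob_ge0.
have S0 : 0 <= S 0 by exact: frob_ge0.
move: (\sum_(t < T) frob (noise t)) (\sum_(t < T) frob (g t)) (\sum_(t < T) S t) N0 g0 SS0.
move: (\sum_(t < T) _) => Nb M Gs Ss M0 G0 Ss0 hd hS.
set B := T%:R * Lf + L1 * Gs in hd hS.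
have B0 : 0 <= B by rewrite addr_ge0// mulr_ge0.
(* divide by 1 - rho >= 99 / 100 and by sm, using rho <= 1 / (100 sm) *)
have hS' : Ss / sm <= 203 / 200 * (S 0 / sm) + 1 / 40 * (M / m%:R) + 21 / 1000 * (eta * B).
  rewrite ler_pdivrMr// -smE.
  have -> : (203 / 200 * (S 0 / sm) + 1 / 40 * (M / (sm * sm)) + 21 / 1000 * (eta * B)) * sm
    = 203 / 200 * S 0 + 1 / 40 * (M / sm) + 21 / 1000 * (eta * B) * sm.
    by field; exact: lt0r_neq0.
  have h1 : rho * M <= 1 / 100 * (M / sm).
    have -> : rho * M = rho * sm * (M / sm) by field; exact: lt0r_neq0.
    by apply: ler_wpM2r => //; rewrite divr_ge0// ltW.
  have h2 : rho * (sm * eta * B) <= 1 / 100 * (sm * eta * B).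
    by apply: ler_wpM2r => //; rewrite !mulr_ge0// ltW.
  have h3 : rho * Ss <= 1 / 100 * Ss by exact: ler_wpM2r.
  have h4 : 0 <= M / sm by rewrite divr_ge0// ltW.
  have h5 : 0 <= sm * eta * B by rewrite !mulr_ge0// ltW.
  move: eta_ge0 L1eta; lra.
have hS'' := ler_wpM2l eta_ge0 hS'.
have hB : eta ^+ 2 * B <= eta ^+ 2 * Lf * T%:R + eta * Gs / 2.
  have : L1 * eta * (eta * Gs) <= 1 / 2 * (eta * Gs) by rewrite ler_wpM2r// mulr_ge0.
  rewrite /B; move: eta_ge0 L1eta; lra.
have eB0 : 0 <= eta ^+ 2 * B by rewrite mulr_ge0// sqr_ge0.
have eG0 : 0 <= eta * Gs by rewrite mulr_ge0.
have eS0 : 0 <= eta * (S 0 / sm) by rewrite mulr_ge0// divr_ge0// ltW.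
have eL0 : 0 <= eta ^+ 2 * Lf * T%:R by rewrite !mulr_ge0// sqr_ge0.
have -> : 203 / 100 * eta / sm * S 0 = 203 / 100 * (eta * (S 0 / sm)) by ring.
have -> : 1 / 20 * eta / m%:R * M = 1 / 20 * (eta * (M / m%:R)) by ring.
have e2 : 2 * eta * (B * (eta / 50) + Nb + Ss / sm) =
  1 / 25 * (eta ^+ 2 * B) + 2 * eta * Nb + 2 * (eta * (Ss / sm)) by field; exact: lt0r_neq0.
have e3 : B * eta ^+ 2 / 2 = 1 / 2 * (eta ^+ 2 * B) by ring.
move: hd hS''; rewrite e2 e3; move: eta_ge0 hf; lra.
Qed.

End Trajectory.


(** * Integration over an independent sample *)

Section Cylinders.
Context {dO : measure_display} {Omega : measurableType dO} {R : realType}.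
Context (P : probability Omega R) {J : choiceType} (E : J -> set (set Omega)).
Hypothesis E_measurable : forall j A, E j A -> measurable A.
Hypothesis E_setI : forall j, setI_closed (E j).
Hypothesis indep : mutually_independent P E.

(** Finite intersections of events taken from the families indexed by [Q]: a
    pi-system generating the information carried by these families. *)
Definition cylinders (Q : set J) : set (set Omega) :=
  [set B | exists (s : seq J) (A : J -> set Omega),
    [/\ uniq s, forall j, j \in s -> Q j /\ E j (A j)
      & B = \big[setI/setT]_(j <- s) A j]].

Local Notation history Q := (g_sigma_algebraType (cylinders Q)).

Lemma cylinders_setI Q : setI_closed (cylinders Q).
Proof.
move=> _ _ [s [A [us sA ->]]] [s' [A' [us' sA' ->]]].
pose B j := (if j \in s then A j else setT) `&` (if j \in s' then A' j else setT).
exists (undup (s ++ s')), B; split.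
- exact: undup_uniq.
- move=> j; rewrite mem_undup mem_cat /B.
  have [js|js] := boolP (j \in s); have [js'|js'] := boolP (j \in s') => //= _.
  + have [Qj EA] := sA _ js; have [_ EA'] := sA' _ js'.
    by split=> //; exact: E_setI.
  + by have [Qj EA] := sA _ js; rewrite setIT.
  + by have [Qj EA] := sA' _ js'; rewrite setTI.
- rewrite -!bigcap_seq; apply/seteqP; split => w.
    move=> [h h'] j /=; rewrite mem_undup mem_cat => jss; split.
      by case: ifPn => // js; apply: h.
    by case: ifPn => // js; apply: h'.
  move=> h; split=> j /= js.
    have /h[] : [set` undup (s ++ s')] j by rewrite /= mem_undup mem_cat js.
    by rewrite js.
  have /h[_] : [set` undup (s ++ s')] j by rewrite /= mem_undup mem_cat js orbT.
  by rewrite js.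
Qed.

Lemma cylinders_measurable Q A : cylinders Q A -> measurable A.
Proof.
move=> [s [B [us sB ->]]]; rewrite -bigcap_seq; apply: fin_bigcap_measurable => //.
by move=> j /= /sB[_ /E_measurable].
Qed.

Lemma history_measurable Q (A : set Omega) :
  measurable (A : set (history Q)) -> measurable A.
Proof.
apply: smallest_sub; first exact: sigma_algebra_measurable.
exact: cylinders_measurable.
Qed.

Lemma event_in_history Q j A : Q j -> E j A -> measurable (A : set (history Q)).
Proof.
move=> Qj EA; apply: sub_sigma_algebra; exists [:: j], (fun=> A); split=> //.
  by move=> k; rewrite inE => /eqP ->.
by rewrite big_seq1.
Qed.

(** Dynkin's pi-lambda theorem: independence extends from cylinders to the
    sigma-algebra that they generate. *)
Lemma history_indep Q j A C : ~ Q j -> E j C -> measurable (A : set (history Q)) ->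
  P (A `&` C) = (P A * P C)%E.
Proof.
move=> nQj EC; have mC := E_measurable EC.
pose good (B : set (history Q)) := P (B `&` C) = (P B * P C)%E.
apply: (@dynkin_induction _ (history Q) (cylinders Q) good).
- by [].
- exact: cylinders_setI.
- by rewrite /good setTI probability_setT mul1e.
- move=> _ [s [B [us sB ->]]]; rewrite /good.
  have js : j \notin s by apply/negP => /sB[].
  have := @indep (j :: s) (fun k => if k == j then C else B k).
  rewrite /= js us => /(_ isT) h; move: h; rewrite !big_cons eqxx.
  have e1 : \big[setI/setT]_(i <- s) (if i == j then C else B i) = \big[setI/setT]_(i <- s) B i.
    by apply: eq_big_seq => k ks; case: eqP => // kj; rewrite -kj ks in js.
  have e2 : (\prod_(i <- s) P (if i == j then C else B i) = \prod_(i <- s) P (B i))%E.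
    by apply: eq_big_seq => k ks; case: eqP => // kj; rewrite -kj ks in js.
  rewrite e1 e2 -(indep us); last by move=> k /sB[].
  rewrite setIC muleC; apply=> k; rewrite inE; case: eqP => [->//|_ /= ks].
  by have [] := sB _ ks.
- move=> B /history_measurable mB gB; rewrite /good; move: B mB gB => /= B mB gB.
  have {}gB : P ((B : set Omega) `&` C) = (P (B : set Omega) * P C)%E := gB.
  rewrite setIC -setDE measureD//; last by rewrite ltey_eq fin_num_measure.
  transitivity (P C - P (B : set Omega) * P C)%E.
    by congr (_ - _)%E; rewrite setIC; exact: gB.
  rewrite -[X in (X - _)%E]mul1e -muleBl ?fin_num_measure//.
  by rewrite -probability_setC.
- move=> F mF tF gF; rewrite /good setI_bigcupl.
  have mF' n : measurable (F n : set Omega) by exact: history_measurable (mF n).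
  rewrite (@measure_semi_bigcup _ _ _ P (fun n => F n `&` C)) //; last 3 first.
  + by move=> n; exact: measurableI.
  + exact: trivIset_setIr.
  + by apply: bigcup_measurable => n _; exact: measurableI.
  rewrite (@measure_semi_bigcup _ _ _ P F)//; last exact: bigcup_measurable.
  have PC : P C = (fine (P C))%:E by rewrite fineK ?fin_num_measure.
  rewrite [RHS]muleC PC -nneseriesZl// -PC.
  by apply: eq_eseriesr => n _; rewrite muleC; exact: gF.
Qed.

Context {dS : measure_display} {S : measurableType dS}.

(** The pair formed by the past and a fresh sample has a product law, so an
    expectation may be computed by first averaging over the fresh sample. *)
Lemma integral_fresh_sample Q j (xi : {mfun Omega >-> S}) (D : probability S R)
    (h : (history Q * S)%type -> \bar R) :
  ~ Q j -> E j = sigma_of xi ->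
  (forall A, measurable A -> distribution P xi A = D A) ->
  measurable_fun setT h -> (forall z, 0 <= h z)%E ->
  (\int[P]_w h (w, xi w) = \int[P]_w \int[D]_s h (w, s))%E.
Proof.
move=> nQj Exi xiD mh h0.
have mc : measurable_fun setT (fun w : Omega => w : history Q).
  by move=> _ A mA; rewrite setTI; exact: (@history_measurable Q A mA).
pose c : {mfun Omega >-> history Q} := HB.pack (fun w : Omega => w : history Q)
  (isMeasurableFun.Build _ _ _ _ _ mc).
have mp : measurable_fun setT (fun w : Omega => (w : history Q, xi w)).
  exact: measurable_fun_pair.
pose p : {mfun Omega >-> (history Q * S)%type} := HB.pack
  (fun w : Omega => (w : history Q, xi w)) (isMeasurableFun.Build _ _ _ _ _ mp).
transitivity (\int[distribution P p]_z h z)%E.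
  by rewrite ge0_integral_distribution.
transitivity (\int[(distribution P c \x D)%E]_z h z)%E.
  apply: eq_measure_integral => A mA _; apply/esym; apply: product_measure_unique => //.
  move=> B C mB mC /=; rewrite -xiD// /distribution /pushforward /=.
  have -> : (fun w : Omega => (w : history Q, xi w)) @^-1` (B `*` C) = B `&` xi @^-1` C.
    by [].
  apply: (history_indep nQj) => //; rewrite Exi; exists C => //; exact: setTI.
rewrite fubini_tonelli1// ge0_integral_distribution//.
- exact: measurable_fun_fubini_tonelli_F.
- by move=> y; apply: integral_ge0.
Qed.

End Cylinders.


(** * Measurability of the iterates *)

Section MatrixMeasurability.
Context {dT : measure_display} {T : measurableType dT} {R : realType}.

Definition mx_measurable {p q} (A : T -> 'M[R]_(p, q)) : Prop :=
  forall i j, measurable_fun setT (fun w => A w i j).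

Lemma mx_measurable_cst p q (B : 'M[R]_(p, q)) : mx_measurable (fun=> B).
Proof. by move=> i j; exact: measurable_cst. Qed.

Lemma mx_measurableD p q (A B : T -> 'M[R]_(p, q)) :
  mx_measurable A -> mx_measurable B -> mx_measurable (fun w => A w + B w).
Proof.
move=> mA mB i j; under eq_fun do rewrite mxE; exact: measurable_funD.
Qed.

Lemma mx_measurableZ p q (a : T -> R) (A : T -> 'M[R]_(p, q)) :
  measurable_fun setT a -> mx_measurable A -> mx_measurable (fun w => a w *: A w).
Proof.
move=> ma mA i j; under eq_fun do rewrite mxE; exact: measurable_funM.
Qed.

Lemma mx_measurableB p q (A B : T -> 'M[R]_(p, q)) :
  mx_measurable A -> mx_measurable B -> mx_measurable (fun w => A w - B w).
Proof.
move=> mA mB; apply: mx_measurableD => //.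
by under eq_fun do rewrite -scaleN1r; apply: mx_measurableZ.
Qed.

Lemma mx_measurable_sum p q (I : Type) (s : seq I) (A : I -> T -> 'M[R]_(p, q)) :
  (forall k, mx_measurable (A k)) -> mx_measurable (fun w => \sum_(k <- s) A k w).
Proof.
move=> mA i j; under eq_fun do rewrite summxE.
by apply: measurable_sum => k; exact: mA.
Qed.

Lemma mx_measurable_mull p q r (B : 'M[R]_(r, p)) (A : T -> 'M[R]_(p, q)) :
  mx_measurable A -> mx_measurable (fun w => B *m A w).
Proof.
move=> mA i j; under eq_fun do rewrite mxE.
by apply: measurable_sum => k; apply: measurable_funM => //; exact: mA.
Qed.

Lemma mx_measurable_row p q (A : T -> 'M[R]_(p, q)) i :
  mx_measurable A -> mx_measurable (fun w => row i (A w)).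
Proof. by move=> mA k j; under eq_fun do rewrite mxE; exact: mA. Qed.

Lemma mx_measurable_rows p q (r : 'I_p -> T -> 'rV[R]_q) :
  (forall i, mx_measurable (r i)) ->
  mx_measurable (fun w => \matrix_(i < p) r i w).
Proof. by move=> mr i j; under eq_fun do rewrite mxE; exact: mr. Qed.

Lemma mx_measurable_mean_row p q (A : T -> 'M[R]_(p, q)) :
  mx_measurable A -> mx_measurable (fun w => mean_row (A w)).
Proof. by move=> mA; apply: mx_measurableZ => //; exact: mx_measurable_mull. Qed.

Lemma mx_measurable_stack p q (x : T -> 'rV[R]_q) :
  mx_measurable x -> mx_measurable (fun w => stack p (x w)).
Proof. by move=> mx; exact: mx_measurable_mull. Qed.

Lemma measurable_sqr_frob p q (A : T -> 'M[R]_(p, q)) :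
  mx_measurable A -> measurable_fun setT (fun w => frob (A w) ^+ 2).
Proof.
move=> mA; under eq_fun do rewrite sqr_frob.
apply: measurable_sum => i; apply: measurable_sum => j.
by apply: measurable_funM; exact: mA.
Qed.

Lemma measurable_frob p q (A : T -> 'M[R]_(p, q)) :
  mx_measurable A -> measurable_fun setT (fun w => frob (A w)).
Proof.
move=> mA; apply: (@measurableT_comp _ _ _ _ _ _ (@Num.sqrt R)).
  exact: continuous_measurable_fun (@sqrt_continuous R).
apply: measurable_sum => i; apply: measurable_sum => j.
by under eq_fun do rewrite expr2; apply: measurable_funM; exact: mA.
Qed.

Lemma mx_measurable_normalize_rows p q (A : T -> 'M[R]_(p, q)) :
  mx_measurable A -> mx_measurable (fun w => normalize_rows (A w)).
Proof.
move=> mA; apply: mx_measurable_rows => i.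
apply: mx_measurableZ; last exact: mx_measurable_row.
(* the power of exponent -1 is known to be measurable on the whole line *)
under eq_fun do rewrite -powR_inv1 ?frob_ge0//.
apply: (@measurableT_comp _ _ _ _ _ _ (fun x : R => x `^ (-1))).
  exact: measurable_powR.
by apply: measurable_frob; exact: mx_measurable_row.
Qed.

Lemma mx_measurable_acc_gossip m d (W : 'M[R]_m) K (Y : T -> 'M[R]_(m, d)) :
  mx_measurable Y -> mx_measurable (fun w => acc_gossip (Y w) W K).
Proof.
move=> mY.
suff : mx_measurable (fun w => (gossip_pair (Y w) W K).1) /\
       mx_measurable (fun w => (gossip_pair (Y w) W K).2) by case.
elim: K => [//|K [IH1 IH2]] /=.
have e1 : (fun w => (let: (B, C) := gossip_pair (Y w) W K in
      ((1 + gossip_momentum W) *: (W *m B) - gossip_momentum W *: C, B)).1) =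
    (fun w => (1 + gossip_momentum W) *: (W *m (gossip_pair (Y w) W K).1)
              - gossip_momentum W *: (gossip_pair (Y w) W K).2).
  by apply/funext => w; case: gossip_pair.
have e2 : (fun w => (let: (B, C) := gossip_pair (Y w) W K in
      ((1 + gossip_momentum W) *: (W *m B) - gossip_momentum W *: C, B)).2) =
    (fun w => (gossip_pair (Y w) W K).1).
  by apply/funext => w; case: gossip_pair.
rewrite e1 e2; split=> //.
apply: mx_measurableB; apply: mx_measurableZ => //.
exact: mx_measurable_mull.
Qed.

End MatrixMeasurability.

Section Caratheodory.
Context {dT dS : measure_display} {T : measurableType dT} {S : measurableType dS}
  {R : realType} {d : nat}.
Variable F : 'rV[R]_d -> S -> R.
Hypothesis mF : forall y, measurable_fun setT (F y).
Variables (x : T -> 'rV[R]_d) (s : T -> S).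
Hypothesis ms : measurable_fun setT s.

Let grid (n : nat) (k : 'rV[int]_d) : 'rV[R]_d := \row_j ((k 0 j)%:~R / n.+1%:R).
Let cell (n : nat) (y : 'rV[R]_d) : 'rV[int]_d := \row_j Num.floor (y 0 j * n.+1%:R).

(** A function of two variables that is continuous in the first and measurable in
    the second: round the first argument to a grid, where it takes countably many
    values, and refine the grid. *)
Lemma caratheodory_measurable : (forall z, continuous (F ^~ z)) ->
  mx_measurable x -> measurable_fun setT (fun w => F (x w) (s w)).
Proof.
move=> cF mx.
apply: (@measurable_fun_cvg _ _ _ _ (fun n w => F (grid n (cell n (x w))) (s w))).
  move=> n _ B mB; rewrite setTI.
  have -> : (fun w => F (grid n (cell n (x w))) (s w)) @^-1` B =
    \bigcup_(k : 'rV[int]_d) ([set w | cell n (x w) = k] `&`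
       (fun w => F (grid n k) (s w)) @^-1` B).
    apply/seteqP; split => [w Bw|w [k _ [/= kE]]]; last by rewrite -kE.
    by exists (cell n (x w)).
  apply: countable_bigcupT_measurable; first exact: countableP.
  move=> k; apply: measurableI; last first.
    have := measurableT_comp (mF (grid n k)) ms; move=> /(_ measurableT B mB).
    by rewrite setTI.
  have -> : [set w | cell n (x w) = k] =
      \bigcap_(j in [set: 'I_d]) [set w | x w 0 j * n.+1%:R \in
        `[(k 0 j)%:~R, (k 0 j + 1)%:~R[ ].
    apply/seteqP; split => w /=.
      by move=> <- j _ /=; rewrite mxE in_itv /=; rewrite -floor_eq.
    move=> h; apply/rowP => j; apply/eqP; rewrite mxE floor_eq.
    by have := h j I; rewrite /= in_itv.
  apply: fin_bigcap_measurable => // j _.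
  have m1 : measurable_fun setT (fun w => x w 0 j * n.+1%:R).
    by apply: measurable_funM => //; exact: mx.
  have := m1 measurableT _ (measurable_itv `[((k 0 j)%:~R : R), (k 0 j + 1)%:~R[).
  by rewrite setTI.
move=> w _; suff gx : grid n (cell n (x w)) @[n --> \oo] --> x w.
  exact: (cvg_comp _ _ gx (cF (s w) (x w))).
apply/cvg_ballP => e e0.
have := @cvg_harmonic R; move=> /cvgrPdist_lt /(_ e e0).
apply: filterS => n /=; rewrite sub0r normrN => ne; split=> // i j.
rewrite /ball /= !ord1 !mxE; apply: le_lt_trans ne; rewrite /harmonic ger0_norm.
  have /andP[h1 h2] := floor_itv (x w 0 j * n.+1%:R).
  rewrite ger0_norm ?invr_ge0// lerBlDr.
  rewrite -[X in X + _]div1r -mulrDl ler_pdivlMr// ltW//.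
  by apply: lt_le_trans h2 _; rewrite intrD addrC.
by rewrite subr_ge0 ler_pdivrMr//; have /andP[] := floor_itv (x w 0 j * n.+1%:R).
Qed.

End Caratheodory.

Section GradientMeasurability.
Context {dT dS : measure_display} {T : measurableType dT} {S : measurableType dS}
  {R : realType} {d : nat}.
Variable F : 'rV[R]_d -> S -> R.
Hypothesis mF : forall y, measurable_fun setT (F y).
Hypothesis dF : forall z y, differentiable (F ^~ z) y.

(** Partial derivatives are limits of difference quotients with increments
    [harmonic n], and these are measurable by [caratheodory_measurable]. *)
Lemma mx_measurable_grad (x : T -> 'rV[R]_d) (s : T -> S) :
  measurable_fun setT s -> mx_measurable x ->
  mx_measurable (fun w => grad (F ^~ (s w)) (x w)).
Proof.
move=> ms mx i j; rewrite ord1 {i}.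
pose ej : 'rV[R]_d := delta_mx 0 j.
under eq_fun do rewrite mxE -/ej.
have cF z : continuous (F ^~ z) by move=> y; exact: differentiable_continuous.
pose q (n : nat) w := n.+1%:R * (F (harmonic n *: ej + x w) (s w) - F (x w) (s w)).
apply: (@measurable_fun_cvg _ _ _ _ q).
  move=> n; apply: measurable_funM => //; apply: measurable_funB.
    apply: caratheodory_measurable => //.
    by apply: mx_measurableD => //; exact: mx_measurable_cst.
  exact: caratheodory_measurable.
move=> w _; have := @diff_derivable _ _ _ (F ^~ (s w)) (x w) ej (dF _ _).
rewrite /derivable => /cvg_ex[l hl].
have -> : 'D_ej (F ^~ (s w)) (x w) = l by exact: cvg_lim hl.
have h0 : @harmonic R @ \oo --> 0^'.
  move=> A /=; rewrite /dnbhs /within /= => hA.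
  have : \forall n \near \oo, harmonic n != 0 :> R -> A (harmonic n).
    exact: (@cvg_harmonic R _ hA).
  by apply: filterS => n; apply; rewrite gt_eqF// harmonic_gt0.
have := cvg_comp _ _ h0 hl; apply: cvg_trans.
apply: near_eq_cvg; apply: nearW => n /=.
by rewrite /harmonic /GRing.scale /= invrK.
Qed.

End GradientMeasurability.

Lemma mx_measurable_grad_det {dT : measure_display} {T : measurableType dT}
    {R : realType} {d : nat} (g : 'rV[R]_d -> R) (x : T -> 'rV[R]_d) :
  (forall y, differentiable g y) ->
  mx_measurable x -> mx_measurable (fun w => grad g (x w)).
Proof.
move=> dg mx; refine (mx_measurable_grad (F := fun y (_ : unit) => g y) (s := fun=> tt)
  _ _ _ mx) => //.
Qed.

Section IterateMeasurability.
Context {dT : measure_display} {T : measurableType dT} {R : realType} {m d : nat}.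
Variables (G : T -> nat -> 'M[R]_(m, d) -> 'M[R]_(m, d)).
Variables (x0 : 'rV[R]_d) (W : 'M[R]_m) (eta : R) (Khat K : nat).

Let X t w := (dnsgd (G w) x0 W eta Khat K t).1.
Let V t w := (dnsgd (G w) x0 W eta Khat K t).2.

Let oracle_measurable t :=
  forall Y : T -> 'M[R]_(m, d), mx_measurable Y -> mx_measurable (fun w => G w t (Y w)).

Let XS t : X t.+1 = fun w => acc_gossip (X t w - eta *: normalize_rows (V t w)) W K.
Proof. by apply/funext => w; rewrite /X /V /=; case: dnsgd. Qed.

Let VS t : V t.+1 =
  fun w => acc_gossip (V t w + G w t.+1 (X t.+1 w) - G w t (X t w)) W K.
Proof. by apply/funext => w; rewrite /X /V /=; case: dnsgd. Qed.

Lemma mx_measurable_dnsgd t : (forall t', (t' <= t)%N -> oracle_measurable t') ->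
  mx_measurable (X t) /\ mx_measurable (V t).
Proof.
elim: t => [h|t IH h].
  split; first exact: mx_measurable_cst.
  by apply: mx_measurable_acc_gossip; apply: h => //; exact: mx_measurable_cst.
have [mX mV] := IH (fun t' tt' => h t' (leqW tt')).
have mX' : mx_measurable (X t.+1).
  rewrite XS; apply: mx_measurable_acc_gossip; apply: mx_measurableB => //.
  by apply: mx_measurableZ => //; exact: mx_measurable_normalize_rows.
split=> //; rewrite VS; apply: mx_measurable_acc_gossip.
by apply: mx_measurableB; [apply: mx_measurableD => //|]; apply: h.
Qed.

(** When each round draws fresh samples, this places the models of round [t] in the
    past of the samples of that round. *)
Lemma mx_measurable_dnsgd_models t :
  (forall t', (t' < t)%N -> oracle_measurable t') -> mx_measurable (X t).
Proof.
case: t => [_|t h]; first exact: mx_measurable_cst.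
have [mX mV] := @mx_measurable_dnsgd t h.
rewrite XS; apply: mx_measurable_acc_gossip; apply: mx_measurableB => //.
by apply: mx_measurableZ => //; exact: mx_measurable_normalize_rows.
Qed.

End IterateMeasurability.


(** * Variance of the stochastic gradients *)

Section Variance.
Context {dS : measure_display} {S : measurableType dS} {R : realType}.
Variable P : probability S R.

Lemma has_expectation_measurable (X : S -> R) c :
  has_expectation P X c -> measurable_fun setT X.
Proof. by move=> [/integrableP[mX _] _]; exact/measurable_EFinP. Qed.

Lemma integral_cst_probability (r : R) : (\int[P]_w r%:E = r%:E)%E.
Proof.
by have := expectation_cst P r; rewrite unlock.
Qed.

(** Adding a centered vector of variance at most [v] to a fixed vector increases
    the expected square norm by at most [v]: the cross term integrates to zero. *)
Lemma centered_increment d (g : S -> 'rV[R]_d) (A c : 'rV[R]_d) (v : R) :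
  (forall j, has_expectation P (fun s => g s 0 j) (c 0 j)) ->
  ('E_P[fun s => (frob (g s - c) ^+ 2)%R] <= v%:E)%E ->
  (\int[P]_s ((frob (A + (g s - c)) ^+ 2)%:E) <= (frob A ^+ 2 + v)%:E)%E.
Proof.
rewrite unlock /= => Eg Ev.
have mg : mx_measurable g by move=> i j; rewrite ord1; exact: has_expectation_measurable (Eg j).
have mgc : mx_measurable (fun s => g s - c).
  by apply: mx_measurableB => //; exact: mx_measurable_cst.
pose Y s := (2 * \sum_j A 0 j * (g s 0 j - c 0 j))%R.
have intY : P.-integrable setT (EFin \o Y) /\ (\int[P]_s (Y s)%:E = 0)%E.
  have ij j : P.-integrable setT (fun s => (A 0 j)%:E * ((g s 0 j)%:E - (c 0 j)%:E))%E.
    have [ig _] := Eg j; apply: integrableZl => //; apply: integrableB => //.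
    exact: finite_measure_integrable_cst.
  have -> : EFin \o Y = (fun s => 2%:E * \sum_j (A 0 j)%:E * ((g s 0 j)%:E - (c 0 j)%:E))%E.
    by apply/funext => s; rewrite /Y /= EFinM -sumEFin.
  under [X in _ /\ X = _]eq_integral => s _.
    rewrite /Y EFinM -sumEFin; under eq_bigr do rewrite EFinM EFinB.
    over.
  have iS : P.-integrable setT (fun s => \sum_j (A 0 j)%:E * ((g s 0 j)%:E - (c 0 j)%:E))%E.
    exact: integrable_sum.
  split; first exact: integrableZl.
  rewrite integralZl// integral_sum// big1 ?mule0// => j _.
  have [ig eg] := Eg j; rewrite integralZl//; last first.
    by apply: integrableB => //; exact: finite_measure_integrable_cst.
  rewrite integralB//; last exact: finite_measure_integrable_cst.
  rewrite integral_cst_probability; move: eg; rewrite unlock /= => ->.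
  by rewrite subee// mule0.
have intN : P.-integrable setT (fun s => (frob (g s - c) ^+ 2)%:E).
  apply/integrableP; split; first exact/measurable_EFinP/measurable_sqr_frob.
  apply: le_lt_trans (ltry v); apply: le_trans Ev.
  apply: ge0_le_integral => //=.
  - by apply/measurable_EFinP; apply: measurableT_comp => //; exact: measurable_sqr_frob.
  - exact/measurable_EFinP/measurable_sqr_frob.
  - by move=> s _; rewrite lee_fin ger0_norm ?sqr_ge0.
have -> : (\int[P]_s (frob (A + (g s - c)) ^+ 2)%:E =
    \int[P]_s ((frob A ^+ 2)%:E + ((Y s)%:E + (frob (g s - c) ^+ 2)%:E)))%E.
  apply: eq_integral => s _; rewrite -!EFinD; congr EFin.
  have -> : Y s = 2 * mdot A (g s - c).
    by rewrite /Y /mdot big_ord1; congr (_ * _); apply: eq_bigr => j _; rewrite !mxE.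
  move: (g s - c) => B; rewrite !sqr_frob mdotDl !mdotDr (mdotC B A); ring.
rewrite integralD//; last 2 first.
- exact: finite_measure_integrable_cst.
- by apply: integrableD => //; case: intY.
rewrite integral_cst_probability integralD//; last by case: intY.
by case: intY => _ ->; rewrite add0e EFinD leeD2l.
Qed.

(** From the second to the first moment, by [2 X <= X ^+ 2 / s + s]. *)
Lemma integral_le_of_sqr (X : S -> R) (s : R) : 0 < s -> (forall w, 0 <= X w) ->
  measurable_fun setT X -> (\int[P]_w ((X w ^+ 2)%:E) <= (s ^+ 2)%:E)%E ->
  (\int[P]_w ((X w)%:E) <= s%:E)%E.
Proof.
move=> s0 X0 mX hX.
apply: (@le_trans _ _ (\int[P]_w (((2 * s)^-1)%:E * (X w ^+ 2)%:E + (s / 2)%:E))%E).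
  apply: ge0_le_integral => //=.
  - by move=> w _; rewrite lee_fin.
  - exact/measurable_EFinP.
  - by apply/measurable_EFinP; apply: measurable_funD => //; apply: measurable_funM => //; exact: measurable_funX.
  - move=> w _; rewrite -EFinM -EFinD lee_fin -subr_ge0.
    have -> : (2 * s)^-1 * X w ^+ 2 + s / 2 - X w = (X w - s) ^+ 2 / (2 * s).
      by field; exact: lt0r_neq0.
    by rewrite divr_ge0 ?sqr_ge0// mulr_ge0// ltW.
have mX2 : measurable_fun setT (fun w => (X w ^+ 2)%:E).
  by apply/measurable_EFinP; exact: measurable_funX.
have i0 : 0 <= (2 * s)^-1 by rewrite invr_ge0 mulr_ge0// ltW.
rewrite ge0_integralD//; last 3 first.
- by move=> w _; rewrite mule_ge0// lee_fin// sqr_ge0.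
- by apply: measurable_funeM.
- by move=> w _; rewrite lee_fin divr_ge0// ltW.
rewrite ge0_integralZl//; last by move=> w _; rewrite lee_fin sqr_ge0.
rewrite integral_cst_probability.
apply: (@le_trans _ _ (((2 * s)^-1)%:E * (s ^+ 2)%:E + (s / 2)%:E)%E).
  by rewrite leeD2r// lee_wpmul2l// lee_fin.
rewrite -EFinM -EFinD lee_fin.
have -> : (2 * s)^-1 * s ^+ 2 + s / 2 = s; last by [].
by field; exact: lt0r_neq0.
Qed.

End Variance.


(** * Noise of the minibatch oracle *)

Section Samples.
Context {dO dS : measure_display} {Omega : measurableType dO} {S : measurableType dS}.
Variable X : {mfun Omega >-> S}.

Lemma sigma_of_measurable A : sigma_of X A -> measurable A.
Proof.
by move=> [B mB <-]; rewrite setTI -[_ @^-1` _]setTI; exact: measurable_funP.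
Qed.

Lemma sigma_of_setI : setI_closed (sigma_of X).
Proof.
move=> _ _ [A mA <-] [B mB <-]; exists (A `&` B); first exact: measurableI.
by rewrite !setTI preimage_setI.
Qed.

End Samples.

Section Noise.
Context {R : realType} {m d b : nat} {dX : 'I_m -> measure_display}
  {Xi : forall i, measurableType (dX i)} {dO : measure_display}
  {Omega : measurableType dO}.
Variables (D : forall i, probability (Xi i) R) (F : forall i, 'rV[R]_d -> Xi i -> R).
Arguments F : clear implicits.
Variables (f : 'I_m -> 'rV[R]_d -> R) (P : probability Omega R).
Variables (xi : forall i, 'I_b -> nat -> {mfun Omega >-> Xi i}).
Variables (tau : {mfun Omega >-> nat}) (sigma : R).
Variables (x0 : 'rV[R]_d) (W : 'M[R]_m) (eta : R) (Khat K : nat).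
Hypothesis df : forall i x, differentiable (f i) x.
Hypothesis dF : forall i s x, differentiable (fun y => F i y s) x.
Hypothesis mF : forall i x, measurable_fun setT (F i x).
Hypothesis Egrad : forall i x j,
  has_expectation (D i) (fun s => grad (fun y => F i y s) x 0 j) (grad (f i) x 0 j).
Hypothesis Evar : forall i x,
  ('E_(D i)[fun s => (frob (grad (fun y => F i y s) x - grad (f i) x) ^+ 2)%R]
    <= (sigma ^+ 2)%:E)%E.
Hypothesis xi_law : forall i k t A, measurable A -> distribution P (xi i k t) A = D i A.
Hypothesis indep : mutually_independent P (sampling_events xi tau).

Local Notation history Q := (g_sigma_algebraType (cylinders (sampling_events xi tau) Q)).

Lemma sampling_measurable j A : sampling_events xi tau j A -> measurable A.
Proof. case: j => [[[i k] t]|]; exact: sigma_of_measurable. Qed.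

Lemma sampling_setI j : setI_closed (sampling_events xi tau j).
Proof. case: j => [[[i k] t]|]; exact: sigma_of_setI. Qed.

Lemma sample_measurable (Q : set (option ('I_m * 'I_b * nat))) i k t :
  Q (Some (i, k, t)) -> measurable_fun (setT : set (history Q)) (fun w => xi i k t w).
Proof.
move=> Qj _ B mB; rewrite setTI.
apply: (event_in_history (j := Some (i, k, t))) => //.
by exists B => //; rewrite setTI.
Qed.

Lemma minibatch_measurable Q t : (forall i k, Q (Some (i, k, t))) ->
  forall Y : history Q -> 'M[R]_(m, d), mx_measurable Y ->
  mx_measurable (fun w : history Q => minibatch F xi w t (Y w)).
Proof.
move=> Qt Y mY; apply: mx_measurable_rows => i; apply: mx_measurableZ => //.
apply: mx_measurable_sum => k.
refine (mx_measurable_grad (@mF i) (@dF i) (x := fun w => row i (Y w))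
  (s := fun w => xi i k t w) _ _); last exact: mx_measurable_row.
exact: sample_measurable.
Qed.

Let X t w := (dnsgd (minibatch F xi w) x0 W eta Khat K t).1.
Let V t w := (dnsgd (minibatch F xi w) x0 W eta Khat K t).2.

Definition sample_noise (p : 'I_m * 'I_b) (t : nat) (w : Omega) : 'rV[R]_d :=
  grad (fun y => F p.1 y (xi p.1 p.2 t w)) (row p.1 (X t w)) - grad (f p.1) (row p.1 (X t w)).

(** What is known once the rounds before [t] are over and, in round [t], the samples
    listed in [s] have been drawn. *)
Definition revealed (t : nat) (s : seq ('I_m * 'I_b)) : set (option ('I_m * 'I_b * nat)) :=
  [set j | if j is Some (p, t') then (t' < t)%N || (t' == t) && (p \in s) else false].

Lemma models_measurable t s : mx_measurable (fun w : history (revealed t s) => X t w).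
Proof.
apply: (@mx_measurable_dnsgd_models _ (history (revealed t s))) => t' tt' Y mY.
by apply: minibatch_measurable => // i k; rewrite /revealed /= tt'.
Qed.

Lemma sample_noise_measurable t s p :
  p \in s -> mx_measurable (fun w : history (revealed t s) => sample_noise p t w).
Proof.
move=> ps; apply: mx_measurableB.
  refine (mx_measurable_grad (@mF p.1) (@dF p.1)
    (x := fun w : history (revealed t s) => row p.1 (X t w))
    (s := fun w => xi p.1 p.2 t w) _ _); last first.
    by apply: mx_measurable_row; exact: models_measurable.
  by apply: sample_measurable; rewrite /revealed /= eqxx -surjective_pairing ps orbT.
by apply: mx_measurable_grad_det => //; apply: mx_measurable_row; exact: models_measurable.
Qed.

Lemma mx_measurable_forget p q Q
    (A : history Q -> 'M[R]_(p, q)) :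
  mx_measurable A -> mx_measurable (A : Omega -> 'M[R]_(p, q)).
Proof.
move=> mA i j _ B mB; rewrite setTI.
apply: (history_measurable sampling_measurable (Q := Q)).
by have := mA i j measurableT B mB; rewrite setTI.
Qed.

(** Reveal the samples of a round one by one: given the past, each new noise term is
    centered, so the variances add up. *)
Lemma sample_noise_variance t (s : seq ('I_m * 'I_b)) : uniq s ->
  (\int[P]_w ((frob (\sum_(p <- s) sample_noise p t w) ^+ 2)%:E)
     <= ((size s)%:R * sigma ^+ 2)%:E)%E.
Proof.
elim: s => [_|p s IH /= /andP[ps us]].
  under eq_integral do rewrite big_nil frob0 expr0n /=.
  by rewrite integral0 mul0r.
pose Q := revealed t s.
have Qs q : q \in s -> mx_measurable (fun w : history Q => sample_noise q t w).
  exact: sample_noise_measurable.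
pose A (w : history Q) := \sum_(q <- s) sample_noise q t w.
have mA : mx_measurable A.
  move=> i j.
  have -> : (fun w => A w i j) =
      fun w => \sum_(q <- s) (if q \in s then sample_noise q t w i j else 0).
    by apply/funext => w; rewrite /A summxE big_seq big_mkcond.
  apply: measurable_sum => q; case: (boolP (q \in s)) => [qs|_].
    exact: (Qs q qs i j).
  exact: measurable_cst.
pose y (w : history Q) := row p.1 (X t w).
have my : mx_measurable y by apply: mx_measurable_row; exact: models_measurable.
pose h (z : (history Q * Xi p.1)%type) : \bar R :=
  (frob (A z.1 + (grad (fun x => F p.1 x z.2) (y z.1) - grad (f p.1) (y z.1))) ^+ 2)%:E.
have mfst q (B : history Q -> 'rV[R]_q) : mx_measurable B ->
    mx_measurable (fun z : (history Q * Xi p.1)%type => B z.1).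
  by move=> mB i j; apply: (measurableT_comp (mB i j)); exact: measurable_fst.
have mh : measurable_fun setT h.
  apply/measurable_EFinP; apply: measurable_sqr_frob; apply: mx_measurableD.
    exact: mfst.
  apply: mx_measurableB; last by apply: mx_measurable_grad_det => //; exact: mfst.
  by refine (mx_measurable_grad (@mF p.1) (@dF p.1) (s := snd) _ (mfst _ _ my)).
have -> : (\int[P]_w ((frob (\sum_(q <- p :: s) sample_noise q t w) ^+ 2)%:E) =
           \int[P]_w h (w, xi p.1 p.2 t w))%E.
  by apply: eq_integral => w _; rewrite big_cons addrC.
rewrite (integral_fresh_sample sampling_measurable sampling_setI indep
  (j := Some (p, t)) (D := D p.1)) //; last 4 first.
- by rewrite /Q /revealed /= ltnn eqxx (negbTE ps).
- by case: (p) => i k.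
- by move=> B mB; exact: xi_law.
- by move=> z; rewrite lee_fin sqr_ge0.
have mA2 : measurable_fun (setT : set Omega) (fun w : Omega => (frob (A w) ^+ 2)%:E).
  by apply/measurable_EFinP; apply: measurable_sqr_frob; exact: (mx_measurable_forget mA).
apply: (@le_trans _ _ (\int[P]_w ((frob (A w) ^+ 2)%:E + (sigma ^+ 2)%:E))%E).
  apply: ge0_le_integral => //=.
  - by move=> w _; apply: integral_ge0 => z _; rewrite lee_fin sqr_ge0.
  - have mi : measurable_fun setT (fubini_F (D p.1) h).
      by apply: measurable_fun_fubini_tonelli_F => // z; rewrite lee_fin sqr_ge0.
    move=> _ B mB; rewrite setTI; apply: (history_measurable sampling_measurable (Q := Q)).
    by have := mi measurableT B mB; rewrite setTI.
  - exact: emeasurable_funD.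
  - move=> w _; rewrite -EFinD.
    exact: (centered_increment (g := fun z => grad (fun x => F p.1 x z) (y w)) (A w)
      (@Egrad p.1 (y w)) (@Evar p.1 (y w))).
rewrite ge0_integralD//; last 2 first.
- by move=> w _; rewrite lee_fin sqr_ge0.
- by move=> w _; rewrite lee_fin sqr_ge0.
rewrite integral_cst_probability -natr1 mulrDl mul1r EFinD leeD2r//.
exact: IH.
Qed.


(** Everything but the output index. *)
Definition all_samples : set (option ('I_m * 'I_b * nat)) := [set j | j != None].

Lemma iterates_measurable t :
  mx_measurable (fun w : history all_samples => X t w) /\
  mx_measurable (fun w : history all_samples => V t w).
Proof.
apply: (@mx_measurable_dnsgd _ (history all_samples)) => t' _ Y mY.
exact: minibatch_measurable.
Qed.

Definition oracle_noise (t : nat) (w : Omega) : 'M[R]_(m, d) :=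
  minibatch F xi w t (X t w) - grad_rows f (X t w).

Lemma oracle_noise_measurable t : mx_measurable (oracle_noise t).
Proof.
have [mX _] := iterates_measurable t.
have mN : mx_measurable (fun w : history all_samples => oracle_noise t w).
  apply: mx_measurableB; first exact: minibatch_measurable.
  by apply: mx_measurable_rows => i; apply: mx_measurable_grad_det => //; exact: mx_measurable_row.
exact: (mx_measurable_forget mN).
Qed.

Lemma row_oracle_noise i t w : (0 < b)%N ->
  row i (oracle_noise t w) = b%:R^-1 *: \sum_(k < b) sample_noise (i, k) t w.
Proof.
move=> b0; rewrite /oracle_noise linearB /= !rowK /sample_noise /= sumrB.
rewrite scalerBr; congr (_ - _); rewrite sumr_const card_ord.
apply/rowP => j; rewrite !mxE mulmxnE -[X in _ * X]mulr_natl mulrA.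
by rewrite mulVf ?mul1r ?mxE// pnatr_eq0 -lt0n.
Qed.

Let variance_Z (a : R) (Z : Omega -> 'rV[R]_d) (v : R) : mx_measurable Z ->
  (\int[P]_w ((frob (Z w) ^+ 2)%:E) <= v%:E)%E ->
  (\int[P]_w ((frob (a *: Z w) ^+ 2)%:E) <= (a ^+ 2 * v)%:E)%E.
Proof.
move=> mZ hZ.
have -> : (\int[P]_w ((frob (a *: Z w) ^+ 2)%:E) =
    (a ^+ 2)%:E * \int[P]_w ((frob (Z w) ^+ 2)%:E))%E.
  rewrite -ge0_integralZl//; last 3 first.
  - by apply/measurable_EFinP; exact: measurable_sqr_frob.
  - by move=> w _; rewrite lee_fin sqr_ge0.
  - by rewrite lee_fin sqr_ge0.
  apply: eq_integral => w _; rewrite -EFinM; congr EFin.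
  by rewrite frobZ exprMn real_normK// num_real.
by rewrite [(_ * v)%:E]EFinM lee_wpmul2l// lee_fin sqr_ge0.
Qed.

Let sum_noise_measurable t (s : seq ('I_m * 'I_b)) :
  mx_measurable (fun w => \sum_(p <- s) sample_noise p t w).
Proof.
apply: mx_measurable_sum => p.
apply: (@mx_measurable_forget _ _ (revealed t [:: p])).
by apply: sample_noise_measurable; rewrite inE.
Qed.

(** Averaging over all agents and samples divides the variance by [m * b]. *)
Lemma integral_mean_noise t (s : R) : (0 < m)%N -> (0 < b)%N -> 0 < s ->
  sigma ^+ 2 / (m%:R * b%:R) <= s ^+ 2 ->
  (\int[P]_w ((frob (mean_row (oracle_noise t w)))%:E) <= s%:E)%E.
Proof.
move=> m0 b0 s0 hs; apply: integral_le_of_sqr => //.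
- by move=> w; exact: frob_ge0.
- by apply: measurable_frob; apply: mx_measurable_mean_row; exact: oracle_noise_measurable.
have e w : mean_row (oracle_noise t w) =
    (m%:R * b%:R)^-1 *: \sum_(p <- enum {: 'I_m * 'I_b}) sample_noise p t w.
  rewrite mean_rowE big_enum /=.
  rewrite -(pair_bigA _ (fun i k => sample_noise (i, k) t w)) /= invfM -scalerA.
  congr (_ *: _); rewrite scaler_sumr; apply: eq_bigr => i _.
  by rewrite row_oracle_noise.
under eq_integral do rewrite e.
apply: le_trans (variance_Z _ (sum_noise_measurable t _) (sample_noise_variance t (enum_uniq _))) _.
rewrite lee_fin -cardE card_prod !card_ord natrM; apply: le_trans hs.
have n0 : (m%:R * b%:R : R) != 0 by rewrite mulf_neq0// pnatr_eq0 -lt0n.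
move: (m%:R * b%:R) n0 => n n0; rewrite le_eqVlt; apply/orP; left; apply/eqP; field.
by [].
Qed.

(** Row by row, averaging [b] samples; the bound is [m * s] since
    [m * (sigma ^+ 2 / b) = m ^+ 2 * (sigma ^+ 2 / (m * b))]. *)
Lemma integral_noise t (s : R) : (0 < m)%N -> (0 < b)%N -> 0 < s ->
  sigma ^+ 2 / (m%:R * b%:R) <= s ^+ 2 ->
  (\int[P]_w ((frob (oracle_noise t w))%:E) <= (m%:R * s)%:E)%E.
Proof.
move=> m0 b0 s0 hs; have mR : (0 : R) < m%:R by rewrite ltr0n.
apply: integral_le_of_sqr => //.
- exact: mulr_gt0.
- by move=> w; exact: frob_ge0.
- by apply: measurable_frob; exact: oracle_noise_measurable.
under eq_integral do rewrite sqr_frob_rows -sumEFin.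
rewrite ge0_integral_sum//; last 2 first.
- move=> i; apply/measurable_EFinP; apply: measurable_sqr_frob.
  by apply: mx_measurable_row; exact: oracle_noise_measurable.
- by move=> i w _; rewrite lee_fin sqr_ge0.
apply: (@le_trans _ _ (\sum_(i < m) (m%:R * s ^+ 2)%:E)%E); last first.
  rewrite sumEFin lee_fin sumr_const card_ord -[X in X <= _]mulr_natl exprMn.
  by rewrite mulrA expr2.
apply: lee_sum => i _.
pose r := [seq (i, k) | k <- enum 'I_b].
have ur : uniq r by rewrite map_inj_uniq ?enum_uniq// => k k' [].
have e w : row i (oracle_noise t w) = b%:R^-1 *: \sum_(p <- r) sample_noise p t w.
  by rewrite row_oracle_noise// /r big_map big_enum.
under eq_integral do rewrite e.
apply: le_trans (variance_Z _ (sum_noise_measurable t r) (sample_noise_variance t ur)) _.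
rewrite lee_fin size_map size_enum_ord.
have b0' : (b%:R : R) != 0 by rewrite pnatr_eq0 -lt0n.
have -> : b%:R^-1 ^+ 2 * (b%:R * sigma ^+ 2) = m%:R * (sigma ^+ 2 / (m%:R * b%:R)).
  by field; rewrite b0' gt_eqF.
by rewrite ler_wpM2l// ltW.
Qed.

(* the point masses below T already have total mass 1 *)
Let uniform_integral (mu : probability nat R) T (g : nat -> R) : (0 < T)%N ->
  (forall t, (t < T)%N -> mu [set t] = (T%:R^-1)%:E) -> (forall t, 0 <= g t) ->
  (\int[mu]_n (g n)%:E = (T%:R^-1 * \sum_(t < T) g t)%:E)%E.
Proof.
move=> T0 muT g0.
pose B : set nat := \big[setU/set0]_(t <- iota 0 T) [set t].
have eB (h : nat -> R) : (forall t, 0 <= h t) ->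
    (\int[mu]_(n in B) (h n)%:E = (T%:R^-1 * \sum_(t < T) h t)%:E)%E.
  move=> h0; rewrite /B ge0_integral_bigsetU//; last 3 first.
  - exact: iota_uniq.
  - by move=> i j _ _ [n [-> ->]].
  - by move=> t _; rewrite lee_fin.
  rewrite mulr_sumr -(big_mkord xpredT (fun t => T%:R^-1 * h t)) /index_iota subn0.
  rewrite -sumEFin big_seq [RHS]big_seq; apply: eq_bigr => t.
  rewrite mem_iota add0n => /andP[_ tT].
  rewrite (eq_integral (fun=> (h t)%:E)) => [|n]; last by rewrite inE => /= ->.
  by rewrite integral_cst//= muT// EFinM muleC.
have muB : mu B = 1%E.
  have := eB (fun=> 1) (fun=> ler01).
  rewrite integral_cst//= mul1e sumr_const card_ord => ->.
  by rewrite mulVf// pnatr_eq0 -lt0n.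
have muBC : mu (~` B) = 0%E by rewrite probability_setC// muB subee.
rewrite -(setUv B) ge0_integral_setU//; last 2 first.
- by move=> t _; rewrite lee_fin.
- by apply/disj_setPS; rewrite setICr.
by rewrite eB// [X in (_ + X)%E]null_set_integral// adde0.
Qed.

(** The output index is independent of all samples, so the expectation at a uniform
    index is the average of the expectations. *)
Lemma integral_uniform_index T (h : nat -> Omega -> R) : (0 < T)%N ->
  (forall t, (t < T)%N -> P (tau @^-1` [set t]) = (T%:R^-1)%:E) ->
  (forall t, measurable_fun (setT : set (history all_samples)) (h t)) ->
  (forall t w, 0 <= h t w) ->
  (\int[P]_w ((h (tau w) w)%:E) =
   (T%:R^-1)%:E * \int[P]_w ((\sum_(t < T) h t w)%:E))%E.
Proof.
move=> T0 tauT mh h0.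
pose H (z : (history all_samples * nat)%type) : \bar R := (h z.2 z.1)%:E.
have mH : measurable_fun setT H.
  apply/measurable_EFinP => _ B mB; rewrite setTI.
  have -> : (fun z : (history all_samples * nat)%type => h z.2 z.1) @^-1` B =
      \bigcup_n ((h n @^-1` B : set (history all_samples)) `*` [set n]).
    apply/seteqP; split => [[w n] /= Bh|[w n] /= [k _ [/= Bh ->]] //].
    by exists n.
  apply: bigcupT_measurable => n; apply: measurableX => //.
  by have := mh n measurableT B mB; rewrite setTI.
rewrite (integral_fresh_sample sampling_measurable sampling_setI indep
  (Q := all_samples) (j := None) (xi := tau) (D := distribution P tau) (h := H))//; last first.
  by move=> z; rewrite lee_fin.
have mhO t : measurable_fun (setT : set Omega) (h t).
  move=> _ B mB; rewrite setTI; apply: (history_measurable sampling_measurable (Q := all_samples)).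
  by have := mh t measurableT B mB; rewrite setTI.
rewrite -ge0_integralZl//; last 2 first.
- by apply/measurable_EFinP; apply: measurable_sum.
- by move=> w _; rewrite lee_fin sumr_ge0.
apply: eq_integral => w _; rewrite -EFinM.
by apply: (@uniform_integral (distribution P tau) T (fun n => h n w) T0).
Qed.

End Noise.


(** * Choice of the parameters *)

Section Tuning.
Context {R : realType}.

(** The last clause is what turns the two lower bounds on the horizon [T] into a lower
    bound on [eta * T]. *)
Lemma step_size (L1 Lf epsilon eta : R) : 0 <= L1 -> 0 < Lf -> 0 < epsilon ->
  eta%:E = mine (epsilon / (4 * Lf + 1))%:E (((2 * L1)%:E)^-1)%E ->
  [/\ 0 < eta, eta * (4 * Lf + 1) <= epsilon, L1 * eta <= 1 / 2 &
      eta = epsilon / (4 * Lf + 1) \/ 0 < L1 /\ 2 * L1 * eta = 1].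
Proof.
move=> L10 Lf0 e0; have c0 : 0 < 4 * Lf + 1 by lra.
have q0 : 0 < epsilon / (4 * Lf + 1) by rewrite divr_gt0.
rewrite inver mulf_eq0 pnatr_eq0 /=; have [-> etaE|L1n0] := eqVneq L1 0.
  have {}etaE : eta = epsilon / (4 * Lf + 1).
    by move: etaE; rewrite min_l ?leey// => -[].
  by rewrite mul0r etaE divfK ?gt_eqF//; split=> //; left.
have L1p : 0 < L1 by rewrite lt_def L1n0.
have p0 : 0 < (2 * L1)^-1 by rewrite invr_gt0 mulr_gt0.
have e1 : 2 * L1 * (2 * L1)^-1 = 1 by rewrite mulfV// gt_eqF// mulr_gt0.
have [h|h] := leP (epsilon / (4 * Lf + 1)) (2 * L1)^-1.
  rewrite min_l ?lee_fin// => -[->]; rewrite divfK ?gt_eqF//; split=> //; last by left.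
  have := ler_wpM2l (ltW L1p) h; lra.
rewrite min_r; last by rewrite lee_fin ltW.
move=> -[->]; split=> //; last by right.
  by rewrite -ler_pdivlMr// ltW.
lra.
Qed.

(** The right-hand side is the square of at most [epsilon / 64]. *)
Lemma batch_size (m b : nat) (Lf epsilon sigma : R) : (0 < m)%N -> (0 < b)%N ->
  0 < Lf -> 0 < epsilon ->
  256 * (4 * Lf + 1) ^+ 2 * sigma ^+ 2 / (m%:R * Lf ^+ 2 * epsilon ^+ 2) <= b%:R ->
  sigma ^+ 2 / (m%:R * b%:R) <= (Lf * epsilon / (16 * (4 * Lf + 1))) ^+ 2.
Proof.
move=> m0 b0 Lf0 e0.
have mR : (0 : R) < m%:R by rewrite ltr0n.
have bR : (0 : R) < b%:R by rewrite ltr0n.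
have c0 : 0 < 4 * Lf + 1 by lra.
rewrite ler_pdivrMr ?mulr_gt0 ?exprn_gt0// => h.
rewrite ler_pdivrMr ?mulr_gt0//.
have -> : (Lf * epsilon / (16 * (4 * Lf + 1))) ^+ 2 * (m%:R * b%:R) =
   b%:R * (m%:R * Lf ^+ 2 * epsilon ^+ 2) / (256 * (4 * Lf + 1) ^+ 2).
  by field; exact: lt0r_neq0.
by rewrite ler_pdivlMr ?mulr_gt0 ?exprn_gt0// mulrC.
Qed.

(** Each source of error is a fraction of [epsilon * eta * N]: 1.015 / 8 for the initial
    gap, 3 / 20 for the second-order terms and 2.05 / 64 for the noise, in total less than
    the 7 / 20 that the conclusion allows. *)
Lemma parameter_balance (Lf epsilon eta N delta v G : R) :
  0 < Lf -> 0 < epsilon -> 0 < eta -> 0 < N -> 0 <= delta -> 0 <= v ->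
  eta * (4 * Lf + 1) <= epsilon ->
  8 * (delta + 2 * v) <= epsilon * eta * N ->
  7 / 10 * eta * G <= delta + 203 / 100 * v + 3 / 5 * eta ^+ 2 * Lf * N
    + 41 / 20 * (eta * N * (Lf * epsilon / (16 * (4 * Lf + 1)))) ->
  N^-1 * G <= epsilon / 2.
Proof.
move=> Lf0 e0 eta0 N0 delta0 v0 hL hT hG.
have c0 : 0 < 4 * Lf + 1 by lra.
have hs : Lf * epsilon / (16 * (4 * Lf + 1)) <= epsilon / 64.
  rewrite ler_pdivrMr ?mulr_gt0//.
  have -> : epsilon / 64 * (16 * (4 * Lf + 1)) = Lf * epsilon + epsilon / 4 by field.
  by rewrite lerDl divr_ge0// ltW.
have eN : 0 < eta * N by rewrite mulr_gt0.
have h1 := ler_wpM2l (ltW eN) hs.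
have h2 : 3 / 5 * eta ^+ 2 * Lf * N <= 3 / 20 * (epsilon * eta * N).
  have h4 : 4 * eta * Lf <= epsilon by lra.
  have := ler_wpM2r (ltW eN) h4; lra.
have h3 : 0 < epsilon * eta * N by rewrite !mulr_gt0.
rewrite mulrC ler_pdivrMr// -(ler_pM2l eta0); lra.
Qed.

End Tuning.

Section IntegralBounds.
Context {dO : measure_display} {Omega : measurableType dO} {R : realType}.
Variable P : probability Omega R.
Implicit Types (g h : Omega -> R).

Lemma integral_addM_le g h (k x y : R) : 0 <= k ->
  measurable_fun setT g -> measurable_fun setT h ->
  (forall w, 0 <= g w) -> (forall w, 0 <= h w) ->
  (\int[P]_w (g w)%:E <= x%:E)%E -> (\int[P]_w (h w)%:E <= y%:E)%E ->
  (\int[P]_w (g w + k * h w)%:E <= (x + k * y)%:E)%E.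
Proof.
move=> k0 mg mh g0 h0 gx hy.
have -> : (\int[P]_w (g w + k * h w)%:E =
    \int[P]_w (g w)%:E + k%:E * \int[P]_w (h w)%:E)%E.
  rewrite -ge0_integralZl//; last 2 first.
  - exact/measurable_EFinP.
  - by move=> w _; rewrite lee_fin.
  rewrite -ge0_integralD//.
  - by move=> w _; rewrite lee_fin.
  - exact/measurable_EFinP.
  - by move=> w _; rewrite lee_fin mulr_ge0.
  - by apply/measurable_EFinP; exact: measurable_funM.
by rewrite EFinD EFinM leeD// lee_wpmul2l.
Qed.

Lemma integral_sum_le (h : nat -> Omega -> R) T (y : R) :
  (forall t, measurable_fun setT (h t)) -> (forall t w, 0 <= h t w) ->
  (forall t, (\int[P]_w (h t w)%:E <= y%:E)%E) ->
  (\int[P]_w (\sum_(t < T) h t w)%:E <= (T%:R * y)%:E)%E.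
Proof.
move=> mh h0 hy; elim: T => [|T IH].
  by under eq_integral do rewrite big_ord0; rewrite integral0 mul0r.
under eq_integral do rewrite big_ord_recr /= -[h T _]mul1r.
rewrite -natr1 mulrDl; apply: integral_addM_le => //.
- exact: measurable_sum.
- by move=> w; exact: sumr_ge0.
Qed.

End IntegralBounds.

Theorem theorem1 (R : realType) :
  exists C : R, 0 < C /\
  forall (m d : nat),
    (0 < m)%N ->
  forall (dX : 'I_m -> measure_display) (Xi : forall i, measurableType (dX i))
    (D : forall i, probability (Xi i) R)
    (F : forall i, 'rV[R]_d -> Xi i -> R)
    (f : 'I_m -> 'rV[R]_d -> R),
    (forall i x, differentiable (f i) x) ->
    (forall i s x, differentiable (fun y => F i y s) x) ->
    (forall i x, has_expectation (D i) (F i x) (f i x)) ->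
    (* (A1) *)
    has_lbound (range (average f)) ->
  forall L0 L1 zeta sigma : R,
    (* (A2) *)
    0 <= L0 -> 0 <= L1 ->
    (forall i, L0L1_smooth L0 L1 (f i)) ->
    (* (A3) *)
    0 <= zeta ->
    (forall i x, frob (grad (f i) x - grad (average f) x) <= zeta) ->
    (* (A4) *)
    0 < sigma ->
    (forall i x j,
      has_expectation (D i) (fun s => grad (fun y => F i y s) x 0 j)
                      (grad (f i) x 0 j)) ->
    (forall i x,
      ('E_(D i)[fun s => (frob (grad (fun y => F i y s) x - grad (f i) x) ^+ 2)%R]
         <= (sigma ^+ 2)%:E)%E) ->
  forall (e : rel 'I_m) (W : 'M[R]_m),
    (* (A5) *)
    mixing_matrix e W ->
  forall Lf gamma epsilon eta : R,
    Lf = L0 + L1 * zeta ->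
    0 < Lf ->
    gamma = 1 - lambda2 W ->
    0 < epsilon ->
    eta%:E = mine (epsilon / (4 * Lf + 1))%:E (((2 * L1)%:E)^-1)%E ->
  forall (x0 : 'rV[R]_d) (Khat K b T : nat),
    K%:Z = Num.ceil (C * ln (Num.sqrt m%:R * (1 + eta)) / Num.sqrt gamma) ->
    (1 <= b)%N -> (1 <= T)%N ->
  forall (dO : measure_display) (Omega : measurableType dO)
    (P : probability Omega R)
    (xi : forall i, 'I_b -> nat -> {mfun Omega >-> Xi i})
    (tau : {mfun Omega >-> nat}),
    (forall i k t A, measurable A -> distribution P (xi i k t) A = D i A) ->
    (forall t, (t < T)%N -> P (tau @^-1` [set t]) = (T%:R^-1)%:E) ->
    mutually_independent P (sampling_events xi tau) ->
    let X := fun t w => (dnsgd (minibatch F xi w) x0 W eta Khat K t).1 in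
    let V := fun t w => (dnsgd (minibatch F xi w) x0 W eta Khat K t).2 in
    let DeltaPhi : \bar R :=
      ((average f x0 - inf (range (average f)))%:E
       + (2 * eta / Num.sqrt m%:R)%:E
         * 'E_P[fun w => frob (V 0%N w - stack m (mean_row (V 0%N w)))%R])%E in
    Num.max (256 * (4 * Lf + 1) ^+ 2 * sigma ^+ 2 / (m%:R * Lf ^+ 2 * epsilon ^+ 2))
            (1024 * L1 ^+ 2 * sigma ^+ 2 / (m%:R * Lf ^+ 2)) <= b%:R ->
    (maxe ((8 * (4 * Lf + 1) / epsilon ^+ 2)%:E * DeltaPhi)
          ((16 * L1 / epsilon)%:E * DeltaPhi) <= T%:R%:E)%E ->
    let xhat := fun w => mean_row (X (tau w) w) in
    ('E_P[fun w => frob (grad (average f) (xhat w))] <= (epsilon / 2)%:E)%E.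
Proof.
(* 80 / 4 = 20 is the power of Num.sqrt m%:R by which a gossip phase contracts *)
exists 80; split; first by [].
move=> m d m0 dX Xi D F f df dF EF lb L0 L1 zeta sigma L00 L10 smooth zeta0 diss sigma0.
move=> Egrad Evar e W mixW Lf gamma epsilon eta LfE Lf0 gammaE eps0 etaE x0 Khat K b T.
move=> KE b1 T1 dO Omega P xi tau xi_law tau_law indep X V DeltaPhi hb hT.
pose xhat w := mean_row (X (tau w) w).
change ('E_P[fun w => frob (grad (average f) (xhat w))] <= (epsilon / 2)%:E)%E.
have [eta0 etaLf L1eta etaD] := step_size L10 Lf0 eps0 etaE.
have c0 : 0 < 4 * Lf + 1 by lra.
have mR : (0 : R) < m%:R by rewrite ltr0n.
have TR : (0 : R) < T%:R by rewrite ltr0n.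
pose sm : R := Num.sqrt m%:R.
have sm0 : 0 < sm by rewrite sqrtr_gt0.
rewrite gammaE in KE.
have [rho [rho0 rho_small gossip_rho]] := acc_gossip_rate m0 mixW (ltW eta0) KE.
pose finf := inf (range (average f)).
have finfP x : finf <= average f x by apply: ge_inf => //; exists x.
have mF i x : measurable_fun setT (F i x) := has_expectation_measurable (EF i x).
pose Gn t w := frob (grad (average f) (mean_row (X t w))).
pose noise := oracle_noise F f xi x0 W eta Khat K.
pose S0 w := consensus_error (V 0%N w).
(* bound on the deviation of the noise averaged over the network *)
pose s := Lf * epsilon / (16 * (4 * Lf + 1)).
have s0 : 0 < s by rewrite divr_gt0 ?mulr_gt0.
have hs : sigma ^+ 2 / (m%:R * b%:R) <= s ^+ 2.
  by apply: batch_size => //; apply: le_trans hb; rewrite le_max lexx.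
have EN t : (\int[P]_w ((frob (mean_row (noise t w)))%:E) <= s%:E)%E.
  exact: (integral_mean_noise x0 W eta Khat K df dF mF Egrad Evar xi_law indep).
have EM t : (\int[P]_w ((frob (noise t w))%:E) <= (m%:R * s)%:E)%E.
  exact: (integral_noise x0 W eta Khat K df dF mF Egrad Evar xi_law indep).
have mnoise t : mx_measurable (noise t) by exact: oracle_noise_measurable.
have path w : 7 / 10 * eta * (\sum_(t < T) Gn t w) <=
    average f x0 - finf + 203 / 100 * eta / sm * S0 w + 3 / 5 * eta ^+ 2 * Lf * T%:R
    + 2 * eta * (\sum_(t < T) frob (mean_row (noise t w)))
    + 1 / 20 * eta / m%:R * (\sum_(t < T) frob (noise t w)).
  exact: (trajectory_bound Khat (minibatch F xi w) x0 LfE (erefl sm) m0 df L10 smooth diss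
    (ltW Lf0) finfP mixW (ltW eta0) L1eta rho0 rho_small (gossip_rho d) T1).
have Ghist t : measurable_fun
    (setT : set (g_sigma_algebraType (cylinders (sampling_events xi tau) all_samples))) (Gn t).
  have [mX _] := iterates_measurable xi tau x0 W eta Khat K dF mF t.
  apply: measurable_frob; apply: mx_measurable_grad_det.
    by move=> y; exact: differentiable_average.
  exact: mx_measurable_mean_row.
have forget (h : Omega -> R) : measurable_fun
    (setT : set (g_sigma_algebraType (cylinders (sampling_events xi tau) all_samples))) h ->
    measurable_fun setT h.
  move=> mh _ B mB; rewrite setTI.
  apply: (history_measurable (@sampling_measurable _ _ _ _ _ _ xi tau) (Q := all_samples)).
  by have := mh measurableT B mB; rewrite setTI.
have mS0 : measurable_fun setT S0.
  apply: forget; have [_ mV] := iterates_measurable xi tau x0 W eta Khat K dF mF 0.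
  apply: measurable_frob; apply: mx_measurableB => //.
  by apply: mx_measurable_stack; exact: mx_measurable_mean_row.
have -> : ('E_P[fun w => frob (grad (average f) (xhat w))] =
    (T%:R^-1)%:E * \int[P]_w ((\sum_(t < T) Gn t w)%:E))%E.
  rewrite unlock; apply: (integral_uniform_index indep (h := Gn)) => // t w.
  exact: frob_ge0.
(* if the initial consensus error had infinite expectation, so would DeltaPhi, and no T
   would be large enough *)
have [r r0 ES0] : exists2 r, 0 <= r & (\int[P]_w (S0 w)%:E = r%:E)%E.
  have I0 : (0 <= \int[P]_w (S0 w)%:E)%E.
    by apply: integral_ge0 => w _; rewrite lee_fin consensus_error_ge0.
  move: hT; rewrite /DeltaPhi unlock.
  move: I0; rewrite -/(S0 _); case: (\int[P]_w (S0 w)%:E)%E => [r|_|//].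
    by rewrite lee_fin => r0 _; exists r.
  rewrite gt0_muley ?lte_fin ?divr_gt0 ?mulr_gt0// addey//.
  by rewrite gt0_muley ?lte_fin ?divr_gt0 ?mulr_gt0 ?exprn_gt0// ge_max.
pose delta := average f x0 - finf.
have delta0 : 0 <= delta by rewrite subr_ge0.
have DE : DeltaPhi = (delta + 2 * (eta / sm * r))%:E.
  rewrite /DeltaPhi unlock; rewrite -/(S0 _) ES0 -EFinM -EFinD; congr EFin.
  by rewrite /delta /sm; ring.
move: hT; rewrite DE -!EFinM ge_max !lee_fin => /andP[hT1 hT2].
have v0 : 0 <= eta / sm * r by rewrite mulr_ge0 ?divr_ge0// ltW.
have hT : 8 * (delta + 2 * (eta / sm * r)) <= epsilon * eta * T%:R.
  move: (delta + _) hT1 hT2 => q hT1 hT2; case: etaD => [->|[L1p L1E]].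
    move: hT1; rewrite mulrAC ler_pdivrMr ?exprn_gt0// => hT1.
    rewrite mulrA -expr2 mulrAC ler_pdivlMr//; lra.
  move: hT2; rewrite mulrAC ler_pdivrMr// => /(ler_wpM2l (ltW eta0)).
  have -> : eta * (16 * L1 * q) = 2 * L1 * eta * (8 * q) by ring.
  by rewrite L1E mul1r; congr (_ <= _); ring.
have mN t : measurable_fun setT (fun w => frob (mean_row (noise t w))).
  by apply: measurable_frob; exact: mx_measurable_mean_row.
have mM t : measurable_fun setT (fun w => frob (noise t w)) by exact: measurable_frob.
have mSum (h : nat -> Omega -> R) : (forall t, measurable_fun setT (h t)) ->
    measurable_fun setT (fun w => \sum_(t < T) h t w).
  by move=> mh; exact: measurable_sum.
have mSN : measurable_fun setT (fun w => \sum_(t < T) frob (mean_row (noise t w))).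
  exact: (mSum (fun t w => frob (mean_row (noise t w))) mN).
have mSM : measurable_fun setT (fun w => \sum_(t < T) frob (noise t w)).
  exact: (mSum (fun t w => frob (noise t w)) mM).
have mG t : measurable_fun setT (Gn t) by exact: forget.
have Lf_ge0 := ltW Lf0; have eta_ge0 := ltW eta0; have sm_ge0 := ltW sm0.
have k0 : 0 <= delta + 3 / 5 * eta ^+ 2 * Lf * T%:R.
  by rewrite addr_ge0// !mulr_ge0// sqr_ge0.
have k1 : 0 <= 203 / 100 * eta / sm by exact: divr_ge0 (mulr_ge0 (divr_ge0 (ler0n _ _) (ler0n _ _)) eta_ge0) sm_ge0.
have k2 : 0 <= 2 * eta by rewrite mulr_ge0.
have k3 : 0 <= 1 / 20 * eta / m%:R by rewrite divr_ge0// mulr_ge0.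
have S0_ge0 w : 0 <= S0 w by exact: consensus_error_ge0.
have sum_ge0 (h : nat -> Omega -> R) w : (forall t, 0 <= h t w) ->
    0 <= \sum_(t < T) h t w.
  by move=> h0; apply: sumr_ge0.
have G_ge0 w : 0 <= \sum_(t < T) Gn t w.
  by apply: (sum_ge0 Gn) => t; exact: frob_ge0.
have N_ge0 w : 0 <= \sum_(t < T) frob (mean_row (noise t w)).
  by apply: (sum_ge0 (fun t w => frob (mean_row (noise t w)))) => t; exact: frob_ge0.
have M_ge0 w : 0 <= \sum_(t < T) frob (noise t w).
  by apply: (sum_ge0 (fun t w => frob (noise t w))) => t; exact: frob_ge0.
have key : ((7 / 10 * eta)%:E * \int[P]_w ((\sum_(t < T) Gn t w)%:E) <=
    (delta + 3 / 5 * eta ^+ 2 * Lf * T%:R + 203 / 100 * eta / sm * r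
     + 2 * eta * (T%:R * s) + 1 / 20 * eta / m%:R * (T%:R * (m%:R * s)))%:E)%E.
  rewrite -ge0_integralZl//; last 3 first.
  - by apply/measurable_EFinP; exact: mSum.
  - by move=> w _; rewrite lee_fin.
  - by rewrite lee_fin mulr_ge0.
  apply: (@le_trans _ _ (\int[P]_w ((delta + 3 / 5 * eta ^+ 2 * Lf * T%:R
      + 203 / 100 * eta / sm * S0 w
      + 2 * eta * (\sum_(t < T) frob (mean_row (noise t w)))
      + 1 / 20 * eta / m%:R * (\sum_(t < T) frob (noise t w)))%:E))%E).
    apply: ge0_le_integral => //.
    + by move=> w _; rewrite -EFinM lee_fin !mulr_ge0.
    + by apply: measurable_funeM; apply/measurable_EFinP; exact: mSum.
    + apply/measurable_EFinP; apply: measurable_funD; last first.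
        by apply: measurable_funM => //; exact: mSM.
      apply: measurable_funD; last by apply: measurable_funM => //; exact: mSN.
      by apply: measurable_funD => //; exact: measurable_funM.
    + move=> w _; rewrite -EFinM lee_fin; apply: le_trans (path w) _.
      by rewrite /delta [X in X + _ + _ <= _]addrAC.
  have m1 : measurable_fun setT (fun w => delta + 3 / 5 * eta ^+ 2 * Lf * T%:R
      + 203 / 100 * eta / sm * S0 w).
    by apply: measurable_funD => //; exact: measurable_funM.
  have m2 : measurable_fun setT (fun w => delta + 3 / 5 * eta ^+ 2 * Lf * T%:R
      + 203 / 100 * eta / sm * S0 w
      + 2 * eta * (\sum_(t < T) frob (mean_row (noise t w)))).
    by apply: measurable_funD => //; apply: measurable_funM => //; exact: mSN.
  have h1 w : 0 <= delta + 3 / 5 * eta ^+ 2 * Lf * T%:R + 203 / 100 * eta / sm * S0 w.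
    by apply: addr_ge0 => //; apply: mulr_ge0.
  apply: integral_addM_le => //; last 2 first.
  - apply: integral_addM_le => //; last 2 first.
    + apply: integral_addM_le => //; first by rewrite integral_cst_probability.
      by rewrite ES0.
    + apply: (integral_sum_le (h := fun t w => frob (mean_row (noise t w)))) => // t w.
      exact: frob_ge0.
  - apply: (integral_sum_le (h := fun t w => frob (noise t w))) => // t w.
    exact: frob_ge0.
  - by move=> w; apply: addr_ge0 => //; apply: mulr_ge0.
have I0 : (0 <= \int[P]_w ((\sum_(t < T) Gn t w)%:E))%E.
  by apply: integral_ge0 => w _; rewrite lee_fin.
have c7 : 0 < 7 / 10 * eta by rewrite mulr_gt0.
move: I0 key; case: (\int[P]_w ((\sum_(t < T) Gn t w)%:E))%E => [I|_|//]; last first.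
  by rewrite gt0_muley ?lte_fin.
move=> _; rewrite -!EFinM !lee_fin => key.
apply: (parameter_balance Lf0 eps0 eta0 TR delta0 v0 etaLf hT).
apply: le_trans key _; rewrite le_eqVlt; apply/orP; left; apply/eqP.
rewrite -/s; field; rewrite !gt_eqF//.
Qed.
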